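(* Let $\phi\in\mathcal A(M)$ have strong limit values $\phi^*$. (1) If $\|\phi\|_{L^p(M)}=A<\infty$ for some $p>1$, then $\|\phi^*\|_{L^p(K_0,\mu)}\le A$, and for every $s$ with $1\le s<p$ the measures $|\phi_j|^s\mu_j$ converge weak-* in $C(K)^*$ to $|\phi^*|^s\mu$. (2) If $\|\phi\|_{L^p(M)}<\infty$ for some $p>1$, $q$ is the conjugate exponent ($1/p+1/q=1$), and $\psi\in\mathcal A^s(M)$ for some $s>q$, with weak limit values $\psi_*$, then the measures $\phi_j\psi_j\mu_j$ converge weak-* in $C(K)^*$ to $\phi^*\psi_*\mu$.
   Context: $K$ is a compact metric space and $M=\{\mu_j\}_{j\ge1}$ is a sequence of finite positive regular Borel measures on $K$ converging weak-* in $C(K)^*$ (i.e. $\int h\,d\mu_j\to\int h\,d\mu$ for all $h\in C(K)$) to a finite positive Borel measure $\mu$. Write $K_j=\operatorname{supp}\mu_j$ and $K_0=\operatorname{supp}\mu$. A ''sequence'' $\phi=\{\phi_j\}$ means a sequence of real-valued Borel functions $\phi_j$ on $K_j$. For $p\ge 1$, $\|\phi\|_{L^p(M)}=\limsup_{j\to\infty}\|\phi_j\|_{L^p(K_j,\mu_j)}$. A sequence $\phi$ has weak limit values $\phi_*$ if $\phi_*$ is a $\mu$-integrable function on $K_0$ and $\int_{K_j}h\phi_j\,d\mu_j\to\int_{K_0}h\phi_*\,d\mu$ for every $h\in C(K)$. $\mathcal A(M)$ is the set of sequences having weak limit values, and $\mathcal A^p(M)$ the set of $\phi\in\mathcal A(M)$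 with $\|\phi\|_{L^p(M)}<\infty$. A sequence $\phi$ has strong limit values $\phi^*$ (a real-valued $\mu$-measurable function on $K_0$) if for all real $a<b$ and all $\varepsilon,\delta>0$ there are $j_0$ and an open set $O\subset K$ containing $G(a,b)=\{x\in K_0:a\le\phi^*(x)<b\}$ such that $\mu_j(\{x\in K_j:\phi_j(x)<a-\varepsilon\}\cap O)+\mu_j(\{x\in K_j:\phi_j(x)>b+\varepsilon\}\cap O)<\delta$ for all $j\ge j_0$. *)

(* Defs.v *)
From HB Require Import structures.
From mathcomp Require Import all_boot all_order all_algebra.
From mathcomp Require Import all_classical all_reals all_analysis.

Set Implicit Arguments.
Unset Strict Implicit.
Unset Printing Implicit Defensive.

Import Order.TTheory GRing.Theory Num.Theory.
Import numFieldNormedType.Exports.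

Local Open Scope classical_set_scope.
Local Open Scope ring_scope.

#[short(type="pointedMetricType")]
HB.structure Definition PointedMetric (K : numDomainType) :=
  { M of Metric K M & Pointed M }.

Notation Borel T := (g_sigma_algebraType (@open T)).

(* The completion of a Borel measure mu: the Caratheodory extension of mu
   from the outer measure it induces; its measurable sets are exactly the
   mu-measurable sets. *)
Notation completion mu := (@completed_measure_extension _ _ _ mu).
Notation Mmeas mu := (measure_extension.caratheodory_type (mu_ext mu)).

Section defs.
Context {R : realType} {T : pointedMetricType R}.


Definition supp (mu : set (Borel T) -> \bar R) : set T :=
  [set x | forall U : set T, open U -> U x -> (0 < mu U)%E].


Definition LpD d (U : measurableType d) (mu : {measure set U -> \bar R})
  (D : set U) (p : R) (f : U -> R) : \bar R :=
  ((\int[mu]_(x in D) (`|f x| `^ p)%:E) `^ p^-1)%E.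

Definition seq_Lpnorm (mu_ : nat -> {measure set (Borel T) -> \bar R})
  (p : R) (phi : nat -> T -> R) : \bar R :=
  limn_esup (fun j => LpD (mu_ j) (supp (mu_ j)) p (phi j)).

Definition is_sequence (mu_ : nat -> {measure set (Borel T) -> \bar R})
  (phi : nat -> T -> R) : Prop :=
  forall j, @measurable_fun _ _ (Borel T) R (supp (mu_ j)) (phi j).

Definition weak_star_cvg (mu_ : nat -> {measure set (Borel T) -> \bar R})
  (mu : {measure set (Borel T) -> \bar R}) : Prop :=
  forall h : T -> R, continuous h ->
    (fun j => (\int[mu_ j]_x (h x)%:E)%E) @ \oo --> (\int[mu]_x (h x)%:E)%E.

Definition weak_limit_values (mu_ : nat -> {measure set (Borel T) -> \bar R})
  (mu : {measure set (Borel T) -> \bar R}) (phi : nat -> T -> R) (phi_ : T -> R)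
  : Prop :=
  (completion mu).-integrable (supp mu) (EFin \o phi_) /\
  forall h : T -> R, continuous h ->
    (fun j => (\int[mu_ j]_(x in supp (mu_ j)) (h x * phi j x)%:E)%E) @ \oo -->
      (\int[completion mu]_(x in supp mu) (h x * phi_ x)%:E)%E.

Definition in_A (mu_ : nat -> {measure set (Borel T) -> \bar R})
  (mu : {measure set (Borel T) -> \bar R}) (phi : nat -> T -> R) : Prop :=
  is_sequence mu_ phi /\ exists phi_, weak_limit_values mu_ mu phi phi_.

Definition in_Ap (mu_ : nat -> {measure set (Borel T) -> \bar R})
  (mu : {measure set (Borel T) -> \bar R}) (p : R) (phi : nat -> T -> R) : Prop :=
  in_A mu_ mu phi /\ (seq_Lpnorm mu_ p phi < +oo)%E.

Definition strong_limit_values (mu_ : nat -> {measure set (Borel T) -> \bar R})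
  (mu : {measure set (Borel T) -> \bar R}) (phi : nat -> T -> R) (phistar : T -> R)
  : Prop :=
  measurable_fun (supp mu : set (Mmeas mu))
    phistar /\
  forall a b : R, a < b -> forall eps delta : R, 0 < eps -> 0 < delta ->
    exists j0 : nat, exists O : set T,
      [/\ open O,
          [set x | supp mu x /\ a <= phistar x < b] `<=` O &
          forall j, (j0 <= j)%N ->
            (mu_ j ([set x | supp (mu_ j) x /\ (phi j x < a - eps)%R] `&` O)
             + mu_ j ([set x | supp (mu_ j) x /\ (b + eps < phi j x)%R] `&` O)
             < delta%:E)%E].

End defs.

(* Main.v *)
(** Truncate at level [N] by [clamp N]. A Lusin-type approximation gives, for all
    [d, e > 0], a continuous [f] with [mu(|f - phistar| >= d) < e]; slicing the range of
    [phistar] and applying the portmanteau inequality to the complement of the open sets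
    that the strong limit values provide, also [mu_j(|phi_j - f| >= d) < e] for large [j].
    Hence in [int h G(clamp N phi_j) psi_j] one may replace [phi_j] by [f], and for fixed
    [f] the function [h G(clamp N f)] is continuous, so the weak limit values of [psi]
    apply. For [N -> oo] the tails are uniformly small by the [L^p] bounds, and the
    integrability of [G(phistar) psi_] follows from duality with continuous functions
    and Fatou's lemma. Part (1) is the case [psi = 1] with [G = |.|^p] for the norm
    bound and [G = |.|^s] for the convergence; part (2) is [G = id]. *)
Require Import Defs.
From HB Require Import structures.
From mathcomp Require Import all_boot all_order all_algebra.
From mathcomp Require Import all_classical all_reals all_analysis.
From mathcomp Require Import measurable_realfun ring lra.
Import Order.TTheory GRing.Theory Num.Theory.
Import numFieldNormedType.Exports.
Local Open Scope classical_set_scope.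
Local Open Scope ring_scope.

Set Implicit Arguments.
Unset Strict Implicit.
Unset Printing Implicit Defensive.

(** * Truncation of the real line to [-N, N] *)

Section Clamp.
Context {R : realType}.
Implicit Types (N t : R).

(** The functions [phi j] live on the supports of different measures, and [phistar] is only
    measurable for the completion of [mu], so they are never compared with each other directly: a
    continuous [f], close in measure to both, is the bridge. Replacing [phi j] by [f] costs the
    integral of |psi_j| over a set of small [mu_ j]-measure. That cost is small uniformly in [j]
    because a bound on |psi_j|^r with r > 1 makes the psi_j uniformly integrable; this is why the
    constant sequence 1 also comes with an exponent, namely 2. On the limit side [psi_] is only
    known to be in L^1(mu), and it is not shown to lie in a better space: the truncated products are
    bounded in L^1 by testing them against continuous functions. This bound involves no smallness of
    tails, so in part (1) it reaches the exponent p, while the convergence needs s < p. *)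

Definition clamp N t : R := Num.max (- N) (Num.min t N).

Lemma clamp_id N t : `|t| <= N -> clamp N t = t.
Proof.
rewrite ler_norml => /andP[h1 h2].
by rewrite /clamp min_l// max_r.
Qed.

Lemma clamp_norm_le N t : 0 <= N -> `|clamp N t| <= N.
Proof.
move=> N0; rewrite /clamp ler_norml le_max lexx /= ge_max ge_min lexx orbT andbT.
by rewrite (le_trans _ N0)// oppr_le0.
Qed.

Lemma norm_clamp_le N t : 0 <= N -> `|clamp N t| <= `|t|.
Proof.
move=> N0; have [h|/ltW h] := leP `|t| N; first by rewrite clamp_id.
by rewrite (le_trans (clamp_norm_le t N0)).
Qed.

Lemma clamp_lip N t u : `|clamp N t - clamp N u| <= `|t - u|.
Proof.
rewrite /clamp; case: (leP t N) => ?; case: (leP u N) => ?;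
  do 2 try (case: (leP (- N) _) => ?);
  rewrite ler_norml; apply/andP; split; have := ler_norm (t - u);
  have := ler_norm (u - t); rewrite (distrC u t); lra.
Qed.

Lemma clamp_continuous N : continuous (clamp N).
Proof.
move=> x; apply/cvgrPdist_le => e e0.
have /cvgrPdist_le/(_ _ e0) : id y @[y --> x] --> x by exact: cvg_id.
by apply: filterS => y; exact/le_trans/clamp_lip.
Qed.

Lemma continuous_clamp_bounded (G : R -> R) N : 0 <= N -> continuous G ->
  exists M, 0 < M /\ forall t, `|G (clamp N t)| <= M.
Proof.
move=> N0 cG; have NN : - N <= N by lra.
have cG' : {within `[- N, N], continuous (fun t => `|G t|)}.
  apply: continuous_subspaceT => t; apply: continuous_comp; first exact: cG.
  exact: norm_continuous.
have [c _ hc] := EVT_max NN cG'.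
exists (`|G c| + 1); split; first by rewrite ltr_wpDl.
move=> t; rewrite (le_trans (hc _ _)) ?lerDl//.
by rewrite in_itv/= -ler_norml clamp_norm_le.
Qed.

(** Heine-Cantor on the segment [-N, N], carried over to all reals because [clamp N] is 1-Lipschitz
    with values in that segment. *)
Lemma continuous_clamp_unif (G : R -> R) N w : 0 <= N -> continuous G -> 0 < w ->
  exists2 d, 0 < d & forall t u, `|t - u| <= d ->
    `|G (clamp N t) - G (clamp N u)| <= w.
Proof.
move=> N0 cG w0.
(* In the near-covering form of compactness the modulus [d] is the filter parameter, tending to 0
   from the right. *)
have /compact_near_coveringP K := @segment_compact R (- N) N.
have := K _ (0 : R)^'+ (fun d x => forall y, `|x - y| <= d -> `|G x - G y| <= w) _.
case.
  move=> x _.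
  have /cvgrPdist_lt/(_ (w / 2)) := cG x.
  rewrite divr_gt0// => /(_ isT) [r /= r0 hr].
  exists (ball x (r / 2), [set d | d < r / 2]).
    split; first by apply: nbhsx_ballx; rewrite divr_gt0.
    by apply: nbhs_right_lt; rewrite divr_gt0.
  move=> [x' d] /= [xx' dr] y x'y.
  have h1 : ball_ Num.norm x r x' by apply: le_ball xx'; lra.
  have h2 : ball_ Num.norm x r y.
    rewrite /ball_/= (_ : x - y = (x - x') + (x' - y)); last by ring.
    rewrite (le_lt_trans (ler_normD _ _))//.
    rewrite (_ : r = r / 2 + r / 2); last by lra.
    by rewrite ltr_leD// (le_trans x'y)// ltW.
  have /= := hr _ h1; have /= := hr _ h2 => g2 g1.
  rewrite (_ : G x' - G y = (G x - G y) - (G x - G x')); last by ring.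
  rewrite (le_trans (ler_normB _ _))//.
  by rewrite (_ : w = w / 2 + w / 2) ?lerD ?ltW//; lra.
move=> r /= r0 hr; exists (r / 2); first by rewrite divr_gt0.
move=> t u tu; apply: (hr (r / 2)) => //=.
- by rewrite sub0r normrN gtr0_norm ?divr_gt0//; lra.
- by rewrite divr_gt0.
- by rewrite in_itv/= -ler_norml clamp_norm_le.
- exact: le_trans (clamp_lip _ _ _) tu.
Qed.

End Clamp.

(** * Elementary inequalities for powers and maxima *)

Section RealBounds.
Context {R : realType}.

(* Splitting at level [L] replaces Hoelder's inequality in the estimates below. *)
Lemma le_truncD_powR (r L t : R) : 1 <= r -> 0 < L -> 0 <= t ->
  t <= L + L `^ (1 - r) * t `^ r.
Proof.
move=> r1 L0 t0; have [tL|/ltW Lt] := leP t L.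
  by rewrite (le_trans tL)// lerDl mulr_ge0// powR_ge0.
apply: ler_wpDl; first exact: ltW.
have t1 : 0 < t by exact: lt_le_trans L0 Lt.
rewrite -[leLHS](@powRr1 _ t)// -{1}(subrK r 1) powRD; last first.
  by rewrite (gt_eqF t1) implybT.
rewrite ler_wpM2r ?powR_ge0// -(opprB r 1) !powRN.
by rewrite lef_pV2 ?posrE ?powR_gt0// ge0_ler_powR ?nnegrE// ?subr_ge0 // ltW.
Qed.

Lemma distr_max_le (a b c e : R) :
  `|Num.max a b - Num.max c e| <= `|a - c| + `|b - e|.
Proof.
have := ler_norm (a - c); have := ler_norm (c - a).
have := ler_norm (b - e); have := ler_norm (e - b).
rewrite (distrC c) (distrC e) ler_norml.
move: `|a - c| `|b - e| => u v.
by case: (leP a b) => ?; case: (leP c e) => ?; move=> *; apply/andP; split; lra.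
Qed.

Lemma powR_nat_cvg0 (a : R) : 0 < a -> forall e : R, 0 < e ->
  \forall N \near \oo, (N.+1%:R : R) `^ (- a) <= e.
Proof.
move=> a0 e e0; near=> N.
rewrite powRN -[leRHS]invrK lef_pV2 ?posrE ?powR_gt0 ?invr_gt0//.
have -> : e^-1 = (e^-1 `^ a^-1) `^ a by rewrite -powRrM mulVf ?gt_eqF// powRr1// invr_ge0 ltW.
rewrite ge0_ler_powR ?nnegrE ?powR_ge0 ?(ltW a0)//.
have /ltW/le_trans : e^-1 `^ a^-1 < N%:R by near: N; exact: nbhs_infty_gtr.
by apply; rewrite ler_nat.
Unshelve. all: by end_near. Qed.

End RealBounds.

(** * Interchange of limits *)

Section Approximation.
Context {R : realType}.

(** The comparison sequence [v] may depend on [e]; three errors of e / 3 add up. It is used with [v]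
    coming from a continuous [f], and again with [v] coming from truncation. *)
Lemma cvg_uniform_approx (u : nat -> R) (l : R) :
  (forall e : R, 0 < e -> exists v m, [/\ v @ \oo --> m, `|m - l| <= e &
     \forall j \near \oo, `|u j - v j| <= e]) ->
  u @ \oo --> l.
Proof.
move=> H; apply/cvgrPdist_le => e e0.
have e3 : 0 < e / 3 by rewrite divr_gt0.
have [v [m [vm ml uv]]] := H _ e3.
move/cvgrPdist_le : vm => /(_ _ e3) vm.
near=> j.
have h1 : `|m - v j| <= e / 3 by near: j.
have h2 : `|u j - v j| <= e / 3 by near: j.
rewrite (_ : l - u j = - (m - l) + (m - v j) - (u j - v j)); last by ring.
rewrite (le_trans (ler_normB _ _))// (le_trans (lerD (ler_normD _ _) (lexx _)))//.
by rewrite normrN; lra.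
Unshelve. all: by end_near. Qed.

Lemma limn_esup_lt_near (u : (\bar R)^nat) (c : \bar R) :
  (limn_esup u < c)%E -> \forall j \near \oo, (u j < c)%E.
Proof.
move=> /ereal_inf_lt [_ [V FV <-]] h.
apply: filterS FV => j Vj; apply: le_lt_trans h.
by apply: ereal_sup_ubound; exists j.
Qed.

End Approximation.

(** * Integrals split along an exceptional set *)

Section RealIntegral.
Context d (X : measurableType d) (R : realType) (m : {measure set X -> \bar R}).
Implicit Types (D E : set X) (F f g psi : X -> R).

Lemma le_integrableR D f g : measurable D -> measurable_fun D f ->
  (forall x, D x -> `|f x| <= g x) -> m.-integrable D (EFin \o g) ->
  m.-integrable D (EFin \o f).
Proof.
move=> mD mf fg; apply: le_integrable => //; first exact/measurable_EFinP.
by move=> x Dx; rewrite /= lee_fin (le_trans (fg x Dx))// ler_norm.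
Qed.

Lemma integrableM_bounded D F psi (M : R) : measurable D ->
  measurable_fun D F -> (forall x, D x -> `|F x| <= M) ->
  m.-integrable D (EFin \o psi) ->
  m.-integrable D (EFin \o (fun x => F x * psi x)).
Proof.
move=> mD mF FM ip.
apply: (@le_integrableR _ _ (fun x => M * `|psi x|)) => //.
- apply: measurable_funM => //; exact/measurable_EFinP/(measurable_int m).
- by move=> x Dx; rewrite normrM ler_wpM2r// FM.
- exact: (integrableZl mD M (integrable_norm ip)).
Qed.

Lemma fin_num_setI D E : measurable D -> measurable E -> (m D < +oo)%E ->
  m (D `&` E) \is a fin_num.
Proof.
move=> mD mE mDoo; rewrite ge0_fin_numE ?measure_ge0//.
by apply: le_lt_trans mDoo; apply: le_measure; rewrite ?inE//; exact: measurableI.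
Qed.

(** [E] is an exceptional set on which [F] is merely bounded: integrate |F psi| <= w |psi| + M |psi|
    1_E. *)
Lemma Rintegral_mul_le D E F psi (w M : R) : measurable D -> measurable E ->
  measurable_fun D F -> m.-integrable D (EFin \o psi) -> 0 <= w -> 0 <= M ->
  (forall x, D x -> `|F x| <= M) -> (forall x, D x -> ~ E x -> `|F x| <= w) ->
  `|\int[m]_(x in D) (F x * psi x)| <=
  w * \int[m]_(x in D) `|psi x| + M * \int[m]_(x in D `&` E) `|psi x|.
Proof.
move=> mD mE mF ip w0 M0 FM Fw.
have iF := integrableM_bounded mD mF FM ip.
have ipn : m.-integrable D (EFin \o (fun x => `|psi x|)) by exact: integrable_norm.
have ipE : m.-integrable D (EFin \o ((fun x => `|psi x|) \_ E)).
  apply: (le_integrableR mD _ _ ipn).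
    apply/measurable_restrict => //; apply: measurable_funS (_ : measurable_fun D _) => //.
    exact/measurable_EFinP/(measurable_int m).
  by move=> x Dx; rewrite patchE; case: ifP; rewrite ?normr_id// normr0.
rewrite Rintegral_mkcondr -!RintegralZl// -RintegralD//; last 2 first.
- exact: (integrableZl mD w ipn).
- exact: (integrableZl mD M ipE).
rewrite (le_trans (le_normr_Rintegral mD iF))//; apply: le_Rintegral => //.
- exact: integrable_norm.
- exact: (integrableD mD (integrableZl mD w ipn) (integrableZl mD M ipE)).
move=> x Dx /=; rewrite normrM patchE; case: ifPn; rewrite (inE, notin_setE) => Ex.
  by rewrite (le_trans (ler_wpM2r _ (FM x Dx)))// lerDr mulr_ge0.
by rewrite mulr0 addr0 ler_wpM2r// Fw.
Qed.

(** Uniform integrability in quantitative form: when r > 1 and the integral of |psi|^r is bounded, a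
    large [L] makes the second term small, and then a small measure of the part of [D] in [E] makes
    the first one small. *)
Lemma Rintegral_norm_le_powR D E psi (r L : R) : measurable D -> measurable E ->
  (m D < +oo)%E -> measurable_fun D psi -> 1 <= r -> 0 < L ->
  m.-integrable D (EFin \o (fun x => `|psi x| `^ r)) ->
  \int[m]_(x in D `&` E) `|psi x| <=
  L * fine (m (D `&` E)) + L `^ (1 - r) * \int[m]_(x in D) (`|psi x| `^ r).
Proof.
move=> mD mE mDoo mpsi r1 L0 ir.
have mDE : measurable (D `&` E) by exact: measurableI.
have DED : D `&` E `<=` D by exact: subIsetl.
have ic c : m.-integrable (D `&` E) (EFin \o (cst c : X -> R)).
  apply: measurable_bounded_integrable => //.
  - by rewrite -ge0_fin_numE ?measure_ge0// fin_num_setI.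
  - by exists `|c|; split; [exact: num_real|move=> t /ltW ? ? _ /=].
have irE := integrableS mD mDE DED ir.
have iz := integrableZl mDE (L `^ (1 - r)) irE.
have h : \int[m]_(x in D `&` E) `|psi x| <=
    \int[m]_(x in D `&` E) (L + L `^ (1 - r) * `|psi x| `^ r).
  have iR : m.-integrable (D `&` E)
      (EFin \o (fun x => L + L `^ (1 - r) * `|psi x| `^ r)).
    exact: (integrableD mDE (ic L) iz).
  apply: le_Rintegral => //.
  - apply: (le_integrableR mDE _ _ iR).
      apply: measurableT_comp => //; exact: measurable_funS mpsi.
    by move=> x _; rewrite normr_id le_truncD_powR.
  - by move=> x _; exact: le_truncD_powR.
rewrite (le_trans h)// RintegralD//; last exact: ic.
rewrite Rintegral_cst// lerD2l RintegralZl// ler_wpM2l ?powR_ge0//.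
rewrite /Rintegral fine_le//.
- by apply: integrable_fin_num => //; exact: irE.
- exact: (integrable_fin_num mD ir).
- by apply: ge0_subset_integral => //; exact: (measurable_int m).
Qed.

End RealIntegral.

(** * Continuous approximation of closed sets in a metric space *)

Section Topology.
Context {R : realType} {T : pointedMetricType R}.
Implicit Types (A C : set T) (h : T -> R).

Lemma continuous_norm_bounded h : compact [set: T] -> continuous h ->
  exists M, 0 < M /\ forall x, `|h x| <= M.
Proof.
move=> cT ch.
have : compact (h @` [set: T]).
  by apply: continuous_compact => //; exact: continuous_subspaceT.
move=> /compact_bounded [M [_ hM]].
exists (Num.max (M + 1) 1); split; first by rewrite lt_max ltr01 orbT.
by move=> x; apply: hM; [rewrite lt_max ltrDl ltr01|exists x].
Qed.

Lemma edist_inf_lty A x : A !=set0 -> (edist_inf A x < +oo)%E.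
Proof.
move=> [a Aa]; have : edist (x, a) \is a fin_num.
  apply/edist_finP; exists (mdist x a + 1); first by rewrite ltr_wpDl// mdist_ge0.
  by rewrite /= ballEmdist/= ltrDl.
rewrite ge0_fin_numE ?edist_ge0//; apply: le_lt_trans.
by apply: ereal_inf_lbound; exists a.
Qed.

Lemma fine_edist_inf_continuous A : A !=set0 ->
  continuous (fine \o edist_inf A : T -> R).
Proof.
move=> [a Aa] x; have /fine_cvgP[_] : edist_inf A y @[y --> x] --> (fine (edist_inf A x))%:E.
  rewrite fineK; first exact: edist_inf_continuous.
  by rewrite ge0_fin_numE ?edist_inf_ge0// edist_inf_lty//; exists a.
by [].
Qed.

(* The approximants are [(1 + dist(x, C))^-n]. *)
Lemma closed_indic_approx C : closed C -> exists h_ : nat -> T -> R,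
  [/\ forall n, continuous (h_ n), forall n x, 0 <= h_ n x <= 1,
      forall n x, C x -> h_ n x = 1 &
      forall x, ~ C x -> h_ n x @[n --> \oo] --> 0].
Proof.
(* The distance to the empty set is +oo, which [fine] sends to 0, so the general formula would give
   the constant 1 instead of functions tending to 0. *)
move=> cC; have [-> {cC}|/set0P C0] := eqVneq C set0.
  exists (fun _ _ => 0); split => //; last by move=> x _; exact: cvg_cst.
  - by move=> n x; exact: cvg_cst.
  - by move=> n x; rewrite lexx ler01.
pose D := (fine \o edist_inf C : T -> R).
have D0 x : 0 <= D x by rewrite /D/= fine_ge0// edist_inf_ge0.
have D1 x : 0 < 1 + D x by rewrite ltr_wpDr.
exists (fun n x => ((1 + D x)^-1) ^+ n); split.
- move=> n x; apply: (@continuous_comp _ _ _ (fun x => (1 + D x)^-1) (@GRing.exp R ^~ n));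
    last exact: exprn_continuous.
  apply: (@continuous_comp _ _ _ (fun x => 1 + D x) GRing.inv);
    last by apply: inv_continuous; rewrite gt_eqF.
  by apply: continuousD; [exact: cst_continuous|exact: fine_edist_inf_continuous].
- move=> n x; rewrite exprn_ge0 ?invr_ge0 ?(ltW (D1 _))//=.
  by rewrite exprn_ile1// ?invr_ge0 ?(ltW (D1 _))// invf_le1// lerDl.
- by move=> n x Cx; rewrite /D/= edist_inf0//= addr0 invr1 expr1n.
move=> x Cx; apply: cvg_expr.
rewrite ger0_norm ?invr_ge0 ?(ltW (D1 _))// invf_lt1// ltrDl.
have : nbhs x (~` C) by apply: open_nbhs_nbhs; split => //; exact: closed_openC.
move=> /nbhs_ballP[e /= e0 eC].
have [c Cc] := C0.
suff : (e%:E <= edist_inf C x)%E.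
  move=> le; rewrite /D/= fine_gt0// (lt_le_trans _ le) ?lte_fin//=.
  by apply: edist_inf_lty; exists c.
apply: le_ereal_inf_tmp => _ [y Cy <-]; rewrite leNgt; apply/negP.
by move=> /edist_lt_ball /eC.
Qed.

End Topology.

(** * Borel sets and supports *)

Section Borel.
Context {R : realType} {T : pointedMetricType R}.
Implicit Types (A C : set T) (h : T -> R).

Lemma open_measurable_Borel A : open A -> measurable (A : set (Borel T)).
Proof. by move=> oA; exact: sub_sigma_algebra. Qed.

Lemma closed_measurable_Borel A : closed A -> measurable (A : set (Borel T)).
Proof.
by move=> cA; rewrite -[A]setCK; apply: measurableC; apply: open_measurable_Borel;
  exact: closed_openC.
Qed.

Lemma continuous_measurable_Borel (D : set (Borel T)) h : continuous h ->
  @measurable_fun _ _ (Borel T) R D h.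
Proof.
move=> /continuousP ch; apply: measurable_funTS.
apply: (measurability _ (RGenOpens.measurableE R)).
move=> _ [_ [a [b ->] <-]]; rewrite setTI; apply: open_measurable_Borel.
exact/ch/interval_open.
Qed.

Lemma supp_closed (mu : {measure set (Borel T) -> \bar R}) : closed (supp mu).
Proof.
rewrite -[supp mu]setCK; apply: open_closedC.
rewrite (_ : ~` supp mu = \bigcup_(U in [set U | open U /\ mu U = 0%E]) U).
  by apply: bigcup_open => U [].
apply/seteqP; split => x /=.
  move=> /existsNP[U /not_implyP[oU /not_implyP[Ux muU]]]; exists U => //=; split => //.
  by apply/eqP; rewrite eq_le measure_ge0 andbT leNgt; apply/negP.
by move=> [U /= [oU muU] Ux] /(_ U oU Ux); rewrite muU ltxx.
Qed.

Lemma measurable_supp (mu : {measure set (Borel T) -> \bar R}) :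
  measurable (supp mu : set (Borel T)).
Proof. by apply: closed_measurable_Borel; exact: supp_closed. Qed.

(** Compactness gives a countable base, and every point off the support lies in a base set of
    measure zero; these are countably many. *)
Lemma measure_suppC (mu : {measure set (Borel T) -> \bar R}) :
  compact [set: T] -> mu (~` supp mu) = 0%E.
Proof.
move=> /compact_second_countable[B cB [oB bB]].
have mS : measurable (~` supp mu : set (Borel T)).
  exact: measurableC (measurable_supp mu).
have cB' : countable (B `&` [set U | mu U = 0%E]).
  by apply: sub_countable cB; apply: subset_card_le; exact: subIsetl.
have [g gB] := @pcard_surjP (set T) nat _ setT cB'.
apply/negligibleP => //.
(* [g] reaches every null base set but may take other values too; the [if] discards them. *)
apply: (@negligibleS _ _ _ mu (\bigcup_k (if g k \in B `&` [set U | mu U = 0%E] then g k else set0))).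
  move=> x /= /existsNP[U /not_implyP[oU /not_implyP[Ux muU]]].
  have [V [BV Vx] VU] := bB x U (open_nbhs_nbhs (conj oU Ux)).
  have V0 : mu V = 0%E.
    apply/eqP; rewrite eq_le measure_ge0 andbT leNgt; apply/negP => h; apply: muU.
    apply: lt_le_trans h _; apply: le_measure => //; rewrite inE.
      by apply: open_measurable_Borel; exact: oB.
    exact: open_measurable_Borel.
  have [k _ gk] := gB V (conj BV V0).
  by exists k => //; rewrite gk ifT ?inE.
apply: negligible_bigcup => k; case: ifPn => [|_]; last exact: negligible_set0.
rewrite inE => -[/oB oV V0]; apply/negligibleP => //; exact: open_measurable_Borel.
Qed.

End Borel.

(** * Markov's inequality and dominated convergence for real integrals *)

Section FiniteMeasureIntegral.
Context d (X : measurableType d) (R : realType) (m : {measure set X -> \bar R}).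
Implicit Types (D E : set X) (F f g psi : X -> R).

Lemma bounded_integrable D f (M : R) : measurable D -> (m D < +oo)%E ->
  measurable_fun D f -> (forall x, D x -> `|f x| <= M) ->
  m.-integrable D (EFin \o f).
Proof.
move=> mD mDoo mf fM; apply: measurable_bounded_integrable => //.
by exists M; split; [exact: num_real|move=> t /ltW Mt x Dx /=; exact: le_trans (fM x Dx) Mt].
Qed.

Lemma Rintegral_indic D E : measurable D -> measurable E ->
  \int[m]_(x in D) (\1_E x : R) = fine (m (D `&` E)).
Proof. by move=> mD mE; rewrite /Rintegral integral_indic// setIC. Qed.

Lemma integrable_indicR D E : measurable D -> measurable E -> (m D < +oo)%E ->
  m.-integrable D (EFin \o (\1_E : X -> R)).
Proof.
move=> mD mE mDoo; apply: (@bounded_integrable _ _ 1) => //.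
by move=> x _; rewrite indicE; case: (_ \in _); rewrite ?normr1 ?normr0 ?ler01.
Qed.

Lemma markov_Rintegral D f (e : R) : measurable D -> (m D < +oo)%E ->
  m.-integrable D (EFin \o f) -> 0 < e ->
  e * fine (m (D `&` [set x | e <= `|f x|])) <= \int[m]_(x in D) `|f x|.
Proof.
move=> mD mDoo intf e0.
have mE : measurable (D `&` [set x | e <= `|f x|]).
  have mf : measurable_fun D (fun x => `|f x|).
    by apply: measurableT_comp => //; exact/measurable_EFinP/(measurable_int m).
  by apply: measurable_fun_le => //; exact: measurable_cst.
have ii := integrable_indicR mD mE mDoo.
rewrite (_ : m _ = m (D `&` (D `&` [set x | e <= `|f x|]))); last by rewrite setIA setIid.
rewrite -Rintegral_indic//.
rewrite -RintegralZl//; apply: le_Rintegral => //.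
- exact: (integrableZl mD e ii).
- exact: integrable_norm.
move=> x Dx; rewrite indicE; have [|_] := boolP (x \in _); last by rewrite mulr0.
by rewrite inE => -[_ /=]; rewrite mulr1.
Qed.

Lemma bounded_cvg_Rintegral D (f_ : nat -> X -> R) f (M : R) :
  measurable D -> (m D < +oo)%E ->
  (forall n, measurable_fun D (f_ n)) -> measurable_fun D f ->
  (forall n x, D x -> `|f_ n x| <= M) ->
  (forall x, D x -> f_ n x @[n --> \oo] --> f x) ->
  (\int[m]_(x in D) `|f_ n x - f x|) @[n --> \oo] --> (0 : R).
Proof.
move=> mD mDoo mf_ mf fM cvf.
have [] := @dominated_convergence _ _ _ m D mD (fun n => EFin \o f_ n) (EFin \o f)
  (EFin \o cst M).
- by move=> n; exact/measurable_EFinP.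
- exact/measurable_EFinP.
- by apply: aeW => x Dx; apply: cvg_EFin; [exact: nearW|exact: cvf].
- by apply: (@bounded_integrable _ _ `|M|) => // x _.
- by apply: aeW => x n Dx; rewrite lee_fin fM.
by move=> _ /fine_cvg + _; exact: cvg_trans.
Qed.

Lemma integrable_cvg_Rintegral D (f_ : nat -> X -> R) f (g : X -> R) :
  measurable D ->
  (forall n, measurable_fun D (f_ n)) -> measurable_fun D f ->
  (forall n x, D x -> `|f_ n x| <= g x) -> m.-integrable D (EFin \o g) ->
  (forall x, D x -> f_ n x @[n --> \oo] --> f x) ->
  m.-integrable D (EFin \o f) /\
  (\int[m]_(x in D) f_ n x) @[n --> \oo] --> \int[m]_(x in D) f x.
Proof.
move=> mD mf_ mf fg ig cvf.
have [] := @dominated_convergence _ _ _ m D mD (fun n => EFin \o f_ n) (EFin \o f)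
  (EFin \o g).
- by move=> n; exact/measurable_EFinP.
- exact/measurable_EFinP.
- by apply: aeW => x Dx; apply: cvg_EFin; [exact: nearW|exact: cvf].
- exact: ig.
- by apply: aeW => x n Dx; rewrite lee_fin fg.
move=> intf _ h; split => //; apply: fine_cvg.
by rewrite fineK//; exact: integrable_fin_num.
Qed.

End FiniteMeasureIntegral.

Section Measurability.
Context d (X : measurableType d) (R : realType).
Implicit Types (D : set X) (f g : X -> R).

Lemma measurable_normR D f : measurable_fun D f -> measurable_fun D (fun x => `|f x|).
Proof. by move=> mf; exact: measurableT_comp. Qed.

Lemma measurable_ge_norm D f (e : R) : measurable D -> measurable_fun D f ->
  measurable (D `&` [set x | e <= `|f x|]).
Proof.
move=> mD mf; apply: measurable_fun_le => //; exact: measurable_normR.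
Qed.

Lemma measurable_continuous_comp D f (G : R -> R) : continuous G ->
  measurable_fun D f -> measurable_fun D (fun x => G (f x)).
Proof.
move=> cG; apply: (@measurableT_comp _ _ _ _ _ _ G).
exact: continuous_measurable_fun.
Qed.

Lemma measurable_norm_powR D f (p : R) :
  measurable_fun D f -> measurable_fun D (fun x => `|f x| `^ p).
Proof. by move=> mf; exact: measurableT_comp (measurable_powR p) (measurable_normR mf). Qed.

End Measurability.

Lemma ereal_cvg_lt_near (R : realType) (u : (\bar R)^nat) (l e : \bar R) :
  u @ \oo --> l -> (l < e)%E -> \forall j \near \oo, (u j < e)%E.
Proof.
move=> ul le; apply: (ul [set x | (x < e)%E]); apply: open_nbhs_nbhs; split => //.
exact: open_ereal_lt_ereal.
Qed.

(** * The completed measure and the portmanteau inequality *)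

Section Completion.
Context {R : realType} {T : pointedMetricType R}.
Variable mu : {finite_measure set (Borel T) -> \bar R}.
Hypothesis cT : compact [set: T].
Implicit Types (A C D : set T) (h : T -> R).

Local Notation nu := (completion mu).

Lemma measurable_completion A :
  measurable (A : set (Borel T)) -> measurable (A : set (Mmeas mu)).
Proof. exact: caratheodory_measurable_mu_ext. Qed.

Lemma completionE A : measurable (A : set (Borel T)) -> nu A = mu A.
Proof. exact: measurable_mu_extE. Qed.

Lemma measurable_fun_completion f :
  @measurable_fun _ _ (Borel T) R setT f -> @measurable_fun _ _ (Mmeas mu) R setT f.
Proof.
move=> mf _ Y mY; apply: measurable_completion; exact: mf.
Qed.

Lemma continuous_measurable_completion (D : set (Mmeas mu)) h : continuous h ->
  @measurable_fun _ _ (Mmeas mu) R D h.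
Proof.
by move=> ch; apply: measurable_funTS; apply: measurable_fun_completion;
  exact: continuous_measurable_Borel.
Qed.

Lemma completion_lty (D : set (Mmeas mu)) : measurable D -> (nu D < +oo)%E.
Proof.
move=> mD; apply: (@le_lt_trans _ _ (nu setT)).
  by apply: le_measure; rewrite ?inE.
by rewrite completionE ?ltey_eq ?fin_num_measure.
Qed.

Lemma finite_measure_lty (D : set (Borel T)) : measurable D -> (mu D < +oo)%E.
Proof. by move=> mD; rewrite ltey_eq fin_num_measure. Qed.

Lemma measurable_supp_completion : measurable (supp mu : set (Mmeas mu)).
Proof. by apply: measurable_completion; exact: measurable_supp. Qed.

Lemma continuous_integrable_completion D h : measurable (D : set (Mmeas mu)) ->
  continuous h -> nu.-integrable D (EFin \o h).
Proof.
move=> mD ch; have [M [_ hM]] := continuous_norm_bounded cT ch.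
apply: (@bounded_integrable _ _ _ _ _ _ M) => //; first exact: completion_lty.
exact: continuous_measurable_completion.
Qed.

Lemma continuous_integrable D h : measurable (D : set (Borel T)) ->
  continuous h -> mu.-integrable D (EFin \o h).
Proof.
move=> mD ch; have [M [_ hM]] := continuous_norm_bounded cT ch.
apply: (@bounded_integrable _ _ _ _ _ _ M) => //; first exact: finite_measure_lty.
exact: continuous_measurable_Borel.
Qed.

(** The identity from the completed to the Borel sigma-algebra is measurable and pushes [nu] forward
    to [mu]. *)
Lemma integral_completion h : continuous h ->
  (\int[nu]_x (h x)%:E = \int[mu]_x (h x)%:E)%E.
Proof.
move=> ch.
have mid : measurable_fun [set: Mmeas mu] (idfun : Mmeas mu -> Borel T).
  by move=> _ Y mY; rewrite setTI; exact: measurable_completion.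
have := @integral_pushforward _ _ (Mmeas mu) (Borel T) R idfun mid nu setT (EFin \o h).
rewrite preimage_setT /=.
move=> <- //.
- by apply: eq_measure_integral => A mA _; rewrite /pushforward/= -completionE.
- by apply/measurable_EFinP; exact: continuous_measurable_Borel.
- exact: continuous_integrable_completion.
Qed.

Lemma integral_supp h : continuous h ->
  (\int[mu]_(x in supp mu) (h x)%:E = \int[mu]_x (h x)%:E)%E.
Proof.
move=> ch; have mS : measurable (~` supp mu : set (Borel T)).
  exact: measurableC (measurable_supp mu).
rewrite [RHS](negligible_integral mS)//.
- by rewrite setTD setCK.
- exact: continuous_integrable.
- exact: measure_suppC.
Qed.

Lemma completion_suppC : nu (~` supp mu) = 0%E.
Proof.
by rewrite completionE ?measure_suppC//; exact: measurableC (measurable_supp mu).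
Qed.

Lemma integral_supp_completion h : continuous h ->
  (\int[nu]_(x in supp mu) (h x)%:E = \int[mu]_x (h x)%:E)%E.
Proof.
move=> ch; have mS : measurable (~` supp mu : set (Mmeas mu)).
  exact: measurableC measurable_supp_completion.
rewrite -integral_completion// [RHS](negligible_integral mS)//.
- by rewrite setTD setCK.
- exact: continuous_integrable_completion.
- exact: completion_suppC.
Qed.

(** The integrals of the continuous approximants of 1_C tend to [mu C], so one of them is already
    below [e]; that approximant can then be used as a test function for weak-* convergence. *)
Lemma closed_measure_lt C (e : \bar R) : closed C -> (mu C < e)%E ->
  exists h, [/\ continuous h, forall x, 0 <= h x, forall x, C x -> 1 <= h x &
    (\int[mu]_x (h x)%:E < e)%E].
Proof.
move=> cC Ce; have [h_ [ch h01 hC hnC]] := closed_indic_approx cC.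
have mC : measurable (C : set (Borel T)) by exact: closed_measurable_Borel.
have cv : (\int[mu]_x (h_ n x)%:E)%E @[n --> \oo] --> mu C.
  have [] := @dominated_convergence _ _ _ mu setT measurableT
    (fun n => EFin \o h_ n) (EFin \o (\1_C : T -> R)) (EFin \o cst 1).
  - by move=> n; apply/measurable_EFinP; exact: continuous_measurable_Borel.
  - exact/measurable_EFinP/measurable_indic.
  - apply: aeW => x _; apply: cvg_EFin; first exact: nearW.
    rewrite /comp /= indicE; have [|] := boolP (x \in C).
      rewrite inE => Cx; under eq_fun do rewrite hC//.
      exact: cvg_cst.
    by rewrite notin_setE => /hnC.
  - exact: finite_measure_integrable_cst.
  - by apply: aeW => x n _ /=; rewrite lee_fin; have /andP[h0 h1] := h01 n x;
      rewrite ger0_norm.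
  by move=> _ _; rewrite integral_indic ?setIT.
have [N _ /(_ N (leqnn _)) hN] := ereal_cvg_lt_near cv Ce.
exists (h_ N); split => //.
- by move=> x; have /andP[] := h01 N x.
- by move=> x /hC ->.
Qed.

End Completion.

(** Portmanteau inequality for closed sets: [mu_ j C] is at most the integral of a continuous
    majorant of 1_C, and these integrals converge to a value below [e]. *)
Lemma weak_star_cvg_closed_lt (R : realType) (T : pointedMetricType R)
    (mu_ : nat -> {finite_measure set (Borel T) -> \bar R})
    (mu : {finite_measure set (Borel T) -> \bar R}) (C : set T) (e : \bar R) :
  compact [set: T] -> weak_star_cvg mu_ mu -> closed C -> (mu C < e)%E ->
  \forall j \near \oo, (mu_ j C < e)%E.
Proof.
move=> cT wmu cC Ce; have [h [ch h0 hC he]] := closed_measure_lt cC Ce.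
have mC : measurable (C : set (Borel T)) by exact: closed_measurable_Borel.
have := ereal_cvg_lt_near (wmu h ch) he.
apply: filterS => j /=; apply: le_lt_trans.
rewrite -[X in (mu_ j X <= _)%E]setIT -integral_indic//.
apply: ge0_le_integral => //.
- by apply/measurable_EFinP/measurable_indic.
- by apply/measurable_EFinP; exact: continuous_measurable_Borel.
- by move=> x _; rewrite lee_fin indicE; have [|_] := boolP (x \in C);
    [rewrite inE => /hC|exact: h0].
Qed.

Lemma Rintegral_norm_le_add d (X : measurableType d) (R : realType)
    (m : {measure set X -> \bar R}) (D : set X) (a b c : X -> R) :
  measurable D -> m.-integrable D (EFin \o a) -> m.-integrable D (EFin \o b) ->
  m.-integrable D (EFin \o c) -> (forall x, D x -> `|c x| <= `|a x| + `|b x|) ->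
  \int[m]_(x in D) `|c x| <= \int[m]_(x in D) `|a x| + \int[m]_(x in D) `|b x|.
Proof.
move=> mD ia ib ic cab.
have ia' := integrable_norm ia; have ib' := integrable_norm ib.
have ic' := integrable_norm ic.
rewrite -RintegralD//; apply: le_Rintegral => //.
exact: (integrableD mD ia' ib').
Qed.

(** * Continuous functions approximate Borel indicators in L^1 *)

Section Density.
Context {R : realType} {T : pointedMetricType R}.
Variable mu : {finite_measure set (Borel T) -> \bar R}.
Hypothesis cT : compact [set: T].
Implicit Types (A B : set T) (F G f : T -> R).

Local Notation nu := (completion mu).
Local Notation intble F := (nu.-integrable [set: Mmeas mu] (EFin \o F)).

(** The L^1 closure of the continuous functions. Integrability is included because the real-valued
    integral turns an infinite value into 0. *)
Definition L1_approximable F := intble F /\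
  forall e : R, 0 < e -> exists f, continuous f /\ \int[nu]_x `|f x - F x| <= e.

Let integrableBR F G : intble F -> intble G -> intble (fun x => F x - G x).
Proof. by move=> iF iG; exact: (integrableB measurableT iF iG). Qed.

Let cont_int f : continuous f -> intble f.
Proof. exact: continuous_integrable_completion. Qed.

Lemma L1_approximable_cont f : continuous f -> L1_approximable f.
Proof.
move=> cf; split; first exact: cont_int.
move=> e e0; exists f; split => //.
under eq_Rintegral do rewrite subrr normr0.
by rewrite Rintegral_cst// mul0r ltW.
Qed.

Lemma L1_approximable_closure F : intble F ->
  (forall e : R, 0 < e -> exists G, L1_approximable G /\ \int[nu]_x `|G x - F x| <= e) ->
  L1_approximable F.
Proof.
move=> iF H; split => // e e0; have e2 : 0 < e / 2 by rewrite divr_gt0.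
have [G [[iG aG] GF]] := H _ e2; have [f [cf fG]] := aG _ e2.
exists f; split => //; rewrite [leRHS](splitr e).
apply: le_trans (lerD fG GF).
apply: Rintegral_norm_le_add => //.
- by apply: integrableBR => //; exact: cont_int.
- exact: integrableBR.
- by apply: integrableBR => //; exact: cont_int.
move=> x _; rewrite (_ : f x - F x = (f x - G x) + (G x - F x)); last by ring.
exact: ler_normD.
Qed.

Lemma L1_approximableD F G : L1_approximable F -> L1_approximable G ->
  L1_approximable (fun x => F x + G x).
Proof.
move=> [iF aF] [iG aG]; have iFG : intble (fun x => F x + G x).
  exact: (integrableD measurableT iF iG).
split=> // e e0; have e2 : 0 < e / 2 by rewrite divr_gt0.
have [f [cf fF]] := aF _ e2; have [g [cg gG]] := aG _ e2.
have cfg : continuous (fun x => f x + g x).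
  by move=> x; apply: continuousD; [exact: cf|exact: cg].
exists (fun x => f x + g x); split => //.
rewrite [leRHS](splitr e); apply: le_trans (lerD fF gG).
apply: Rintegral_norm_le_add => //.
- by apply: integrableBR => //; exact: cont_int.
- by apply: integrableBR => //; exact: cont_int.
- by apply: integrableBR => //; exact: cont_int.
move=> x _; rewrite (_ : _ - _ = (f x - F x) + (g x - G x)); last by ring.
exact: ler_normD.
Qed.

Lemma L1_approximableZ (a : R) F : L1_approximable F ->
  L1_approximable (fun x => a * F x).
Proof.
move=> [iF aF]; have iaF : intble (fun x => a * F x).
  exact: (integrableZl measurableT a iF).
split=> // e e0.
have a1 : 0 < `|a| + 1 by rewrite ltr_wpDl.
have [f [cf fF]] := aF (e / (`|a| + 1)) (divr_gt0 e0 a1).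
have caf : continuous (fun x => a * f x).
  by move=> x; apply: continuousM; [exact: cst_continuous|exact: cf].
exists (fun x => a * f x); split => //.
under eq_Rintegral do rewrite -mulrBr normrM.
rewrite RintegralZl//; last first.
  by apply: integrable_norm; apply: integrableBR => //; exact: cont_int.
rewrite (le_trans (ler_wpM2l _ fF))// mulrA ler_pdivrMr// mulrC ler_pM2l//.
by rewrite lerDl.
Qed.

(** Serves finite unions, whose indicator is the maximum of the indicators; the maximum preserves
    continuity and is 1-Lipschitz in each argument. *)
Lemma L1_approximable_max F G : L1_approximable F -> L1_approximable G ->
  intble (fun x => Num.max (F x) (G x)) ->
  L1_approximable (fun x => Num.max (F x) (G x)).
Proof.
move=> [iF aF] [iG aG] iFG.
split=> // e e0; have e2 : 0 < e / 2 by rewrite divr_gt0.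
have [f [cf fF]] := aF _ e2; have [g [cg gG]] := aG _ e2.
have cfg : continuous (fun x => Num.max (f x) (g x)).
  by move=> x; apply: continuous_max; [exact: cf|exact: cg].
exists (fun x => Num.max (f x) (g x)); split => //.
rewrite [leRHS](splitr e); apply: le_trans (lerD fF gG).
apply: Rintegral_norm_le_add => //.
- by apply: integrableBR => //; exact: cont_int.
- by apply: integrableBR => //; exact: cont_int.
- by apply: integrableBR => //; exact: cont_int.
by move=> x _; exact: distr_max_le.
Qed.

Definition approximable_sets : set (set T) := [set A | measurable (A : set (Mmeas mu)) /\
  L1_approximable (\1_A : T -> R)].

Let indic_int A : measurable (A : set (Mmeas mu)) -> intble (\1_A : T -> R).
Proof.
by move=> mA; apply: integrable_indicR => //; exact: completion_lty.
Qed.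

Lemma L1_approximable_closed A : closed A -> approximable_sets A.
Proof.
move=> cA; have mA : measurable (A : set (Mmeas mu)).
  by apply: measurable_completion; exact: closed_measurable_Borel.
split => //; split => [|e e0]; first exact: indic_int.
have [h_ [ch h01 hA hnA]] := closed_indic_approx cA.
have hM n x : [set: Mmeas mu] x -> `|h_ n x| <= 1.
  by move=> _; have /andP[h0 h1] := h01 n x; rewrite ger0_norm.
have hcv x : [set: Mmeas mu] x -> h_ n x @[n --> \oo] --> (\1_A x : R).
  move=> _; rewrite indicE; have [|] := boolP (x \in A).
    rewrite inE => Ax; under eq_fun do rewrite hA//.
    exact: cvg_cst.
  by rewrite notin_setE => /hnA.
have /cvgr0Pnorm_le/(_ _ e0)[N _ /(_ N (leqnn _)) /= hN] :
    (\int[nu]_x `|h_ n x - \1_A x|) @[n --> \oo] --> (0 : R).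
  have mh n : @measurable_fun _ _ (Mmeas mu) R setT (h_ n).
    exact: continuous_measurable_completion.
  have mi : @measurable_fun _ _ (Mmeas mu) R setT \1_A by exact: measurable_indic.
  exact: (bounded_cvg_Rintegral measurableT (completion_lty measurableT) mh mi hM hcv).
by exists (h_ N); split => //; rewrite (le_trans (ler_norm _)).
Qed.

(** Complements correspond to 1 - 1_A, finite unions to maxima, and a countable union is the L^1
    limit of its finite partial unions by bounded convergence, the measure being finite. *)
Lemma approximable_sets_sigma_algebra : sigma_algebra [set: T] approximable_sets.
Proof.
split.
- exact: L1_approximable_closed closed0.
- move=> A [mA aA]; rewrite setTD; split; first exact: measurableC.
  rewrite (_ : \1_(~` A) = (fun x => 1 + -1 * \1_A x) :> (T -> R)); last first.
    apply/funext => x; rewrite !indicE in_setC; case: (x \in A); rewrite /=; ring.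
  apply: L1_approximableD; last exact: L1_approximableZ.
  by apply: L1_approximable_cont => x; exact: cvg_cst.
move=> A aA.
have mA : measurable ((\bigcup_k A k) : set (Mmeas mu)).
  by apply: bigcup_measurable => k _; have [] := aA k.
split => //; apply: L1_approximable_closure => [|e e0]; first exact: indic_int.
pose B n : set T := \big[setU/set0]_(k < n) A k.
have aB n : approximable_sets (B n).
  rewrite /B; elim: n => [|n [mB aB]].
    by rewrite big_ord0; exact: L1_approximable_closed closed0.
  have [mAn aAn] := aA n.
  rewrite big_ord_recr /=; set C := \big[setU/set0]_(k < n) A k.
  have mU : measurable (C `|` A n : set (Mmeas mu)) by exact: measurableU.
  split => //.
  have E : \1_(C `|` A n) = (fun x => Num.max (\1_C x) (\1_(A n) x)) :> (T -> R).
    apply/funext => x; rewrite !indicE in_setU.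
    by case: (x \in C); case: (x \in A n); rewrite /= maxEle ?lexx ?ler01 ?ler10.
  by rewrite E; apply: L1_approximable_max => //; rewrite -E; exact: indic_int.
have hM n x : [set: Mmeas mu] x -> `|\1_(B n) x : R| <= 1.
  by move=> _; rewrite indicE; case: (_ \in _); rewrite ?normr1 ?normr0.
have hcv x : [set: Mmeas mu] x -> (\1_(B n) x : R) @[n --> \oo] --> (\1_(\bigcup_k A k) x : R).
  move=> _; have [[k _ Akx]|nA] := pselect ((\bigcup_k A k) x).
    rewrite [X in _ --> X]indicE mem_set; last by exists k.
    apply: cvg_near_cst; near=> n; rewrite indicE mem_set//.
    rewrite /B -bigcup_mkord; exists k => //=; near: n; exact: nbhs_infty_gt.
  rewrite [X in _ --> X]indicE memNset//.
  apply: cvg_near_cst; near=> n; rewrite indicE memNset//.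
  by rewrite /B -bigcup_mkord => -[k _ Akx]; apply: nA; exists k.
have /cvgr0Pnorm_le/(_ _ e0)[N _ /(_ N (leqnn _)) /= hN] :
    (\int[nu]_x `|\1_(B n) x - \1_(\bigcup_k A k) x|) @[n --> \oo] --> (0 : R).
  have mB n : @measurable_fun _ _ (Mmeas mu) R setT \1_(B n).
    by apply: measurable_indic; have [] := aB n.
  have mU : @measurable_fun _ _ (Mmeas mu) R setT \1_(\bigcup_k A k).
    exact: measurable_indic.
  exact: (bounded_cvg_Rintegral measurableT (completion_lty measurableT) mB mU hM hcv).
exists (\1_(B N)); split; first by have [] := aB N.
by rewrite (le_trans (ler_norm _)).
Unshelve. all: by end_near. Qed.

Lemma L1_approximable_Borel A : measurable (A : set (Borel T)) -> approximable_sets A.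
Proof.
move=> mA; have := @smallest_sub _ (sigma_algebra [set: T]) (@open T) approximable_sets.
apply => //; first exact: approximable_sets_sigma_algebra.
move=> U oU; rewrite -[U]setCK -setTD.
have [_ aC _] := approximable_sets_sigma_algebra; apply: aC.
by apply: L1_approximable_closed; exact: open_closedC.
Qed.

End Density.

(** [clamp 1 (k * t)] is a continuous stand-in for the sign of [t]. It differs from the sign only
    where |t| < 1 / k, and there the left side is negative. *)
Lemma ler_mul_clamp (R : realType) (k t : R) : 0 < k ->
  `|t| - k^-1 <= t * clamp 1 (k * t).
Proof.
move=> k0; have ki : 0 < k^-1 by rewrite invr_gt0.
have [h|h] := leP `|k * t| 1.
  rewrite clamp_id// mulrCA -expr2.
  apply: (@le_trans _ _ 0); last by rewrite mulr_ge0 ?sqr_ge0// ltW.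
  by rewrite subr_le0 -[leRHS]mul1r ler_pdivlMr// -[X in _ * X]gtr0_norm// -normrM mulrC.
have [t0|t0] := leP 0 t.
  have kt : 1 < k * t by rewrite -[X in 1 < X]ger0_norm// mulr_ge0// ltW.
  have -> : clamp 1 (k * t) = 1 by rewrite /clamp min_r ?ltW// max_r//; lra.
  by rewrite mulr1 ger0_norm// gerBl ltW.
have kt : k * t < -1.
  by rewrite ltrNr -ltr0_norm// pmulr_rlt0.
have -> : clamp 1 (k * t) = -1 by rewrite /clamp min_l ?max_l//; lra.
by rewrite mulrN1 ltr0_norm// gerBl ltW.
Qed.

(** The sign is computed from [t] but applied to [u]. The error |t - u| is paid twice: once for |u|
    <= |t| + |t - u|, once for replacing [t] by [u] in the product. *)
Lemma le_norm_clamp_approx (R : realType) (k t u : R) : 0 < k ->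
  `|u| <= (clamp 1 (k * t) * u + k^-1) + (`|t - u| + `|t - u|).
Proof.
move=> k0; have := ler_mul_clamp t k0; set h := clamp _ _ => ht.
have h1 : `|h| <= 1 by exact: clamp_norm_le.
have a1 : `|u| <= `|t| + `|t - u|.
  by rewrite [X in `|X|](_ : u = t - (t - u)) ?ler_normB//; ring.
have a2 : h * (t - u) <= `|t - u|.
  by rewrite (le_trans (ler_norm _))// normrM ler_piMl.
rewrite mulrBr (mulrC h t) in a2.
move: a1 a2 ht; move: `|u| `|t| `|t - u| (h * u) (t * h) k^-1 => *; lra.
Qed.

(** * Approximation in measure and L^1 duality with continuous functions *)

Section Lusin.
Import HBSimple.
Context {R : realType} {T : pointedMetricType R}.
Variable mu : {finite_measure set (Borel T) -> \bar R}.
Hypothesis cT : compact [set: T].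
Implicit Types (A B : set T) (F G f : T -> R).

Local Notation nu := (completion mu).
Local Notation intble F := (nu.-integrable [set: Mmeas mu] (EFin \o F)).

(** [nu A] is an infimum over countable Borel covers of [A]; [B] is the union of a cover that is
    optimal up to [e]. *)
Lemma completion_outer_Borel A (e : R) : measurable (A : set (Mmeas mu)) -> 0 < e ->
  exists B, [/\ measurable (B : set (Borel T)), A `<=` B & (nu (B `\` A) < e%:E)%E].
Proof.
move=> mA e0.
have nuA : nu A \is a fin_num.
  by rewrite ge0_fin_numE ?measure_ge0//; exact: completion_lty.
have [_ [F [mF AF] <-] FA] := lb_ereal_inf_adherent e0 nuA.
have mB : measurable (\bigcup_k F k : set (Borel T)) by exact: bigcup_measurable.
exists (\bigcup_k F k); split => //.
have mB' := measurable_completion mu mB.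
have -> : nu ((\bigcup_k F k) `\` A) = (nu (\bigcup_k F k) - nu A)%E.
  rewrite measureD//; last exact: completion_lty.
  by rewrite setIidr.
rewrite lteBlDl//; apply: le_lt_trans FA.
rewrite completionE//; exact: measure_sigma_subadditive.
Qed.

Lemma L1_approximable_indic A : measurable (A : set (Mmeas mu)) ->
  L1_approximable mu (\1_A : T -> R).
Proof.
move=> mA; apply: L1_approximable_closure => //.
  by apply: integrable_indicR => //; exact: completion_lty.
move=> e e0; have [B [mB AB BA]] := completion_outer_Borel mA e0.
have [mB' aB] := L1_approximable_Borel mu cT mB.
exists (\1_B); split => //.
have mBA : measurable (B `\` A : set (Mmeas mu)) by exact: measurableD.
have -> : (fun x => `|\1_B x - \1_A x : R|) = \1_(B `\` A).
  apply/funext => x; rewrite !indicE in_setD.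
  have [Ax|_] := boolP (x \in A).
    by rewrite mem_set/= ?subrr ?normr0 ?andbF//; apply: AB; rewrite inE in Ax.
  by rewrite subr0 andbT; case: (x \in B); rewrite ?normr1 ?normr0.
rewrite Rintegral_indic// setTI -lee_fin fineK; first exact: ltW.
by rewrite ge0_fin_numE ?measure_ge0//; exact: completion_lty.
Qed.

Lemma continuous_dense_L1 F : intble F -> L1_approximable mu F.
Proof.
move=> iF; apply: L1_approximable_closure => // e e0.
have [g_ [ig _ cg]] := approximation_sfun_integrable measurableT iF.
have /fine_cvgP[_ /cvgr0Pnorm_le/(_ _ e0)[N _ /(_ N (leqnn _)) /= hN]] := cg.
pose g : T -> R := (g_ N : Mmeas mu -> R).
exists g; split; last first.
  under eq_Rintegral do rewrite distrC.
  exact: le_trans (ler_norm _) hN.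
(* The finite range is turned into a list, so that closure under linear combinations applies by
   induction on it. *)
have [s gs] : exists s : seq R, g = (fun x => \sum_(y <- s) (y * \1_(g @^-1` [set y]) x)).
  exists (finmap.enum_fset (fset_set (range g))).
  by apply/funext => x; rewrite [LHS](fimfunE (g_ N) x) fsbig_finite.
rewrite gs; elim: s {gs} => [|y s IH].
  under eq_fun do rewrite big_nil.
  by apply: L1_approximable_cont => // x; exact: cvg_cst.
under eq_fun do rewrite big_cons.
apply: L1_approximableD => //; apply: L1_approximableZ => //.
by apply: L1_approximable_indic; exact: measurable_funPTI.
Qed.

(** [theta] need not be integrable, so it is truncated at a level exceeded only on a small set. The
    truncation is integrable, and Markov's inequality turns its L^1 approximation by [f] into
    closeness in measure. *)
Lemma lusin_measure (theta : T -> R) :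
  @measurable_fun _ _ (Mmeas mu) R (supp mu) theta ->
  forall d e : R, 0 < d -> 0 < e -> exists f, continuous f /\
    (nu (supp mu `&` [set x | (d <= `|f x - theta x|)%R]) < e%:E)%E.
Proof.
move=> mth d e d0 e0; have mS := measurable_supp_completion mu.
pose th := theta \_ (supp mu).
have mthT : @measurable_fun _ _ (Mmeas mu) R setT th.
  exact: ((@measurable_restrictT _ _ (Mmeas mu) R (supp mu) theta mS).1 mth).
(* [theta] is real-valued, so these sets decrease to the empty set. *)
pose E (n : nat) := [set x | (n%:R : R) <= `|th x|].
have mE n : measurable (E n : set (Mmeas mu)).
  by rewrite -[E n]setTI; exact: (measurable_ge_norm _ measurableT mthT).
have e4 : 0 < e / 4 by rewrite divr_gt0.
have e44 : e / 4 + e / 4 < e by clear -e0; lra.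
have /cvgr0Pnorm_le/(_ _ e4)[N _ /(_ N (leqnn _)) /= hN] :
    (\int[nu]_x `|\1_(E n) x - 0|) @[n --> \oo] --> (0 : R).
  have mi n : @measurable_fun _ _ (Mmeas mu) R setT \1_(E n) by exact: measurable_indic.
  have m0 : @measurable_fun _ _ (Mmeas mu) R setT (fun=> 0) by exact: measurable_cst.
  have hM n x : [set: Mmeas mu] x -> `|\1_(E n) x : R| <= 1.
    by move=> _; rewrite indicE; case: (_ \in _); rewrite ?normr1 ?normr0.
  have hcv x : [set: Mmeas mu] x -> (\1_(E n) x : R) @[n --> \oo] --> (0 : R).
    move=> _; apply: cvg_near_cst; near=> n.
    have hn : `|th x| < n%:R by near: n; exact: nbhs_infty_gtr.
    by rewrite indicE memNset// /E /= leNgt hn.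
  exact: (bounded_cvg_Rintegral measurableT (completion_lty measurableT) mi m0 hM hcv).
have E1 : (fun x => `|\1_(E N) x - 0| : R) = \1_(E N).
  by apply/funext => x; rewrite subr0 ger0_norm// indicE ler0n.
rewrite E1 Rintegral_indic// setTI ger0_norm ?fine_ge0// in hN.
pose F := fun x => clamp N%:R (th x).
have mF : @measurable_fun _ _ (Mmeas mu) R setT F.
  exact: (measurable_continuous_comp (@clamp_continuous R N%:R) mthT).
have iF : intble F.
  apply: (bounded_integrable measurableT (completion_lty measurableT) mF (M := N%:R)).
  by move=> x _; exact: clamp_norm_le.
have [_ aF] := continuous_dense_L1 iF.
(* With this L^1 error, Markov's inequality at height [d] leaves a set of measure at most e / 4. *)
have de4 : 0 < d * (e / 4) by rewrite mulr_gt0.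
have [f [cf fF]] := aF _ de4; exists f; split => //.
have ifF : intble (fun x => f x - F x).
  exact: (integrableB measurableT (continuous_integrable_completion cT measurableT cf) iF).
have := markov_Rintegral measurableT (completion_lty measurableT) ifF d0.
move=> /le_trans/(_ fF); rewrite ler_pM2l// setTI => hM.
set M := [set x | _] in hM.
have mM : measurable (M : set (Mmeas mu)).
  have mfF : @measurable_fun _ _ (Mmeas mu) R setT (fun x => f x - F x).
    exact/measurable_EFinP/(measurable_int _ ifF).
  by rewrite -[M]setTI; exact: (measurable_ge_norm _ measurableT mfF).
have nuE : nu (E N) \is a fin_num by rewrite ge0_fin_numE ?measure_ge0//; exact: completion_lty.
have nuM : nu M \is a fin_num by rewrite ge0_fin_numE ?measure_ge0//; exact: completion_lty.
apply: (@le_lt_trans _ _ (nu (E N `|` M))).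
  apply: le_measure; rewrite ?inE; last 2 first.
  - exact: measurableU.
  - move=> x [Sx /= dx]; have [NE|EN] := leP N%:R `|th x|; [by left|right].
    by rewrite /M /= /F (clamp_id (ltW EN)) /th patchE mem_set.
  have mf : @measurable_fun _ _ (Mmeas mu) R (supp mu) f.
    exact: continuous_measurable_completion.
  exact: (measurable_ge_norm _ mS (measurable_funB mf mth)).
apply: (@le_lt_trans _ _ (nu (E N) + nu M)%E); first exact: measureU2.
rewrite -(fineK nuE) -(fineK nuM) -EFinD lte_fin.
exact: le_lt_trans (lerD hN hM) e44.
Unshelve. all: by end_near. Qed.

(** The test function is the approximate sign [clamp 1 (k * f x)] of a continuous L^1 approximation
    [f] of [F]. Only continuous test functions occur because weak limit values control no others. *)
Lemma Rintegral_norm_le_dual F (C : R) :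
  nu.-integrable (supp mu) (EFin \o F) ->
  (forall h : T -> R, continuous h -> (forall x, `|h x| <= 1) ->
     `|\int[nu]_(x in supp mu) (h x * F x)| <= C) ->
  \int[nu]_(x in supp mu) `|F x| <= C.
Proof.
move=> iF hC; have mS := measurable_supp_completion mu.
apply/ler_addgt0Pr => e e0.
pose G := F \_ (supp mu).
have iG : intble G.
  rewrite -restrict_EFin.
  exact: ((@integrable_mkcond _ _ _ (completion mu) _ (EFin \o F) mS).1 iF).
have [_ aG] := continuous_dense_L1 iG.
have e3 : 0 < e / 3 by rewrite divr_gt0.
have [f [cf fG]] := aG _ e3.
pose V := fine (nu setT); have V0 : 0 <= V by rewrite fine_ge0.
(* Makes k^-1 V at most e / 3; the other two thirds of [e] pay twice for the L^1 distance from [f]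
   to [G]. The + 1 keeps [k] positive when V = 0. *)
pose k := (V + 1) * 3 / e.
have k0 : 0 < k by rewrite divr_gt0// mulr_gt0// ltr_wpDl.
pose h x := clamp 1 (k * f x).
have ch : continuous h.
  move=> x; apply: (@continuous_comp _ _ _ (fun x => k * f x) (clamp 1)).
    by apply: continuousM; [exact: cst_continuous|exact: cf].
  exact: clamp_continuous.
have h1 x : `|h x| <= 1 by exact: clamp_norm_le.
have mh : @measurable_fun _ _ (Mmeas mu) R setT h by exact: continuous_measurable_completion.
have ihG : intble (fun x => h x * G x).
  exact: (integrableM_bounded measurableT mh (fun x _ => h1 x) iG).
have inG := integrable_norm iG.
have ifc : intble f by exact: continuous_integrable_completion.
have idG := integrable_norm (integrableB measurableT ifc iG).
have ik : intble (cst k^-1).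
  by apply: continuous_integrable_completion => // x; exact: cvg_cst.
have E1 : \int[nu]_(x in supp mu) `|F x| = \int[nu]_x `|G x|.
  rewrite Rintegral_mkcond; apply: eq_Rintegral => x _.
  by rewrite /G !patchE; case: ifP; rewrite ?normr0.
have E2 : \int[nu]_(x in supp mu) (h x * F x) = \int[nu]_x (h x * G x).
  rewrite Rintegral_mkcond; apply: eq_Rintegral => x _.
  by rewrite /G !patchE; case: ifP; rewrite ?mulr0.
have le1 : \int[nu]_x `|G x| <=
    \int[nu]_x ((h x * G x + k^-1) + (`|f x - G x| + `|f x - G x|)).
  apply: le_Rintegral => //.
    exact: (integrableD measurableT (integrableD measurableT ihG ik)
      (integrableD measurableT idG idG)).
  move=> x _; exact: le_norm_clamp_approx.
rewrite E1 (le_trans le1)// RintegralD//; last 2 first.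
- exact: (integrableD measurableT ihG ik).
- exact: (integrableD measurableT idG idG).
rewrite RintegralD// RintegralD// Rintegral_cst// -E2.
have VE : k^-1 * V <= e / 3.
  rewrite /k invf_div mulrAC ler_pdivrMr; last by rewrite mulr_gt0// ltr_wpDl.
  have -> : e / 3 * ((V + 1) * 3) = e * V + e by field.
  by rewrite lerDl ltW.
rewrite [leRHS](_ : _ = (C + e / 3) + (e / 3 + e / 3)); last by field.
apply: lerD; last exact: lerD.
by apply: lerD => //; apply: le_trans (ler_norm _) (hC _ ch h1).
Qed.

End Lusin.

(** * From strong limit values to approximation in measure *)

Section StrongLimits.
Context {R : realType} {T : pointedMetricType R}.
Variables (mu_ : nat -> {finite_measure set (Borel T) -> \bar R})
  (mu : {finite_measure set (Borel T) -> \bar R})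
  (phi : nat -> T -> R) (phistar : T -> R).
Hypothesis cT : compact [set: T].
Hypothesis wmu : weak_star_cvg mu_ mu.
Hypothesis mphi : is_sequence mu_ phi.
Hypothesis sphi : strong_limit_values mu_ mu phi phistar.

Local Notation nu := (completion mu).
Local Notation bad f d j := (supp (mu_ j) `&` [set x | (d <= `|phi j x - f x|)%R]).

Lemma measurable_bad (f : T -> R) (d : R) j : continuous f ->
  measurable (bad f d j : set (Borel T)).
Proof.
move=> cf; have mS := measurable_supp (mu_ j).
have mf : @measurable_fun _ _ (Borel T) R (supp (mu_ j)) f.
  exact: continuous_measurable_Borel.
exact: (measurable_ge_norm _ mS (measurable_funB (@mphi j) mf)).
Qed.

(* On a slice [b <= phistar < b + e] where [f] is [e]-close to [phistar], [phi j] and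
   [f] both lie in [b - e, b + 2 e] up to a set of small measure. *)
Lemma strong_limit_slices (f : T -> R) (e : R) : continuous f -> 0 < e ->
  forall (k : nat) (a eta : R), 0 < eta -> exists W : set T, [/\ open W,
    forall x, supp mu x -> a <= phistar x < a + k%:R * e ->
      `|f x - phistar x| < e -> W x &
    \forall j \near \oo, (mu_ j (bad f (4 * e)%R j `&` W) < eta%:E)%E].
Proof.
move=> cf e0; elim=> [|k IH] a eta eta0.
  exists set0; split; first exact: open0.
    by move=> x _ /andP[h1 h2]; move: (le_lt_trans h1 h2); rewrite mul0r addr0 ltxx.
  by apply: nearW => j; rewrite setI0 measure0 lte_fin.
have eta2 : 0 < eta / 2 by rewrite divr_gt0.
have [W [oW hW nW]] := IH a _ eta2.
pose b := a + k%:R * e.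
have be : b < b + e by rewrite ltrDl.
have bE : a + k.+1%:R * e = b + e by rewrite /b -natr1 mulrDl mul1r addrA.
have [_ hs] := sphi.
have [j0 [U [oU GU hO]]] := hs b (b + e) be e (eta / 2) e0 eta2.
(* [U] controls only [phi j]; the preimage confines [f] as well and, being open, keeps the enlarged
   set open. *)
pose V : set T := U `&` (f @^-1` `]b - e, b + e + e[%classic).
have oV : open V.
  apply: openI => //; move/continuousP : cf => cf; apply: cf; exact: interval_open.
exists (W `|` V); split.
- exact: openU.
- move=> x Sx /andP[ax xb] fx; have [xb'|xb'] := ltP (phistar x) b.
    by left; apply: hW => //; rewrite ax.
  right; split.
    by apply: GU; split => //; rewrite xb' -bE.
  move: fx xb xb'; rewrite /= in_itv/= ltr_norml bE.
  move=> /andP[? ?] ? ?; apply/andP; split; lra.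
near=> j.
have hW' : (mu_ j (bad f (4 * e)%R j `&` W) < (eta / 2)%:E)%E by near: j.
have hO' := hO j _.
have mb : measurable (bad f (4 * e)%R j : set (Borel T)) by exact: measurable_bad.
have mW : measurable (W : set (Borel T)) by exact: open_measurable_Borel.
have mU : measurable (U : set (Borel T)) by exact: open_measurable_Borel.
have mV : measurable (V : set (Borel T)) by exact: open_measurable_Borel.
set A1 : set (Borel T) := [set x | _ /\ phi j x < b - e] in hO'.
set A2 : set (Borel T) := [set x | _ /\ b + e + e < phi j x] in hO'.
have mA1 : measurable A1.
  have := mphi (measurable_supp (mu_ j)) (measurable_itv `]-oo, (b - e)[).
  by congr (measurable _); apply/seteqP; split => x /=; rewrite in_itv/=.
have mA2 : measurable A2.
  have := mphi (measurable_supp (mu_ j)) (measurable_itv `](b + e + e), +oo[).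
  by congr (measurable _); apply/seteqP; split => x /=; rewrite in_itv/= andbT.
apply: (@le_lt_trans _ _ (mu_ j (bad f (4 * e)%R j `&` W) +
   (mu_ j (A1 `&` U) + mu_ j (A2 `&` U)))%E); last first.
  rewrite (splitr eta) EFinD; apply: lteD => //; apply: hO'.
  near: j; exact: nbhs_infty_ge.
apply: (@le_trans _ _ (mu_ j ((bad f (4 * e)%R j `&` W) `|` ((A1 `&` U) `|` (A2 `&` U))))).
  apply: le_measure; rewrite ?inE.
  - by apply: measurableI => //; exact: measurableU.
  - by apply: measurableU; [exact: measurableI|apply: measurableU; exact: measurableI].
  move=> x [[Sx /= dx] [Wx|[Ux /=]]]; first by left.
  rewrite in_itv/= => /andP[f1 f2]; right.
  have [h1|h1] := ltP (phi j x) (b - e); first by left; split.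
  have [h2|h2] := ltP (b + e + e) (phi j x); first by right; split.
  exfalso; move: dx; apply/negP; rewrite -ltNge ltr_norml; apply/andP; split; lra.
apply: (@le_trans _ _ (mu_ j (bad f (4 * e)%R j `&` W) +
    mu_ j ((A1 `&` U) `|` (A2 `&` U)))%E).
  by apply: measureU2; [exact: measurableI|apply: measurableU; exact: measurableI].
by apply: leeD => //; apply: measureU2; exact: measurableI.
Unshelve. all: by end_near. Qed.

(** One and the same [f] serves [mu] and all large [j]. A point of [supp mu] escapes the open set
    [W] built from the slices only where [f] is far from [phistar], so the complement of [W]
    inherits its small measure from the Lusin approximation. *)
Lemma strong_limit_cvg_measure (d e : R) : 0 < d -> 0 < e -> exists f, [/\ continuous f,
  (nu (supp mu `&` [set x | (d <= `|f x - phistar x|)%R]) < e%:E)%E &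
  \forall j \near \oo, (mu_ j (bad f d j) < e%:E)%E].
Proof.
move=> d0 e0; have e2 : 0 < e / 2 by rewrite divr_gt0.
have d4 : 0 < d / 4 by rewrite divr_gt0.
have mS := measurable_supp_completion mu.
have [mphistar _] := sphi.
have [f [cf hf]] := lusin_measure cT mphistar d4 e2.
have [M [M0 hM]] := continuous_norm_bounded cT cf.
(* Where |f - phistar| < d / 4, the bound |f| <= M puts [phistar] in [-n d / 4, n d / 4), which n +
   n slices of width d / 4 cover. The width is d / 4 because the slices lose a factor 4. *)
have [n hn] : exists n : nat, M + d / 4 <= n%:R * (d / 4).
  have [n _ /(_ n (leqnn n)) hn] := @nbhs_infty_ger R ((M + d / 4) / (d / 4)).
  by exists n; rewrite -ler_pdivrMr.
have [W [oW hW nW]] := strong_limit_slices cf d4 (n + n) (- (n%:R * (d / 4))) e2.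
have mf : @measurable_fun _ _ (Mmeas mu) R (supp mu) f.
  exact: continuous_measurable_completion.
have mN (c : R) : measurable (supp mu `&` [set x | c <= `|f x - phistar x|] : set (Mmeas mu)).
  exact: (measurable_ge_norm _ mS (measurable_funB mf mphistar)).
exists f; split => //.
  apply: (@le_lt_trans _ _ (nu (supp mu `&` [set x | d / 4 <= `|f x - phistar x|]))).
    apply: le_measure; rewrite ?inE//; apply: setIS => x /=; apply: le_trans.
    by rewrite ler_pdivrMr// ler_peMr ?ler1n// ltW.
  by apply: lt_trans hf _; rewrite lte_fin ltr_pdivrMr// ltr_pMr// ltr1n.
have cW : closed (~` W) by exact: open_closedC.
have mWB : measurable (W : set (Borel T)) by exact: open_measurable_Borel.
have mWM : measurable (~` W : set (Mmeas mu)).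
  by apply: measurable_completion; exact: measurableC.
have hW' : (mu (~` W) < (e / 2)%:E)%E.
  rewrite -completionE; last exact: measurableC.
  apply: le_lt_trans hf.
  have -> : nu (supp mu `&` [set x | d / 4 <= `|f x - phistar x|]) =
     (nu (~` supp mu) + nu (supp mu `&` [set x | (d / 4 <= `|f x - phistar x|)%R]))%E.
    by rewrite completion_suppC// add0e.
  apply: le_trans (measureU2 _ (measurableC mS) (mN _)).
  apply: le_measure; rewrite ?inE//.
    by apply: measurableU; [exact: measurableC mS|exact: mN].
  move=> x nWx; have [Sx|] := pselect (supp mu x); last by left.
  right; split => //=; rewrite leNgt; apply/negP => fx; apply: nWx; apply: hW => //.
  have := hM x; move: fx; rewrite ltr_norml ler_norml => /andP[f1 f2] /andP[g1 g2].
  rewrite natrD mulrDl; move: hn f1 f2 g1 g2.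
  move: (n%:R * (d / 4)) => u hn f1 f2 g1 g2; apply/andP; split; lra.
have := weak_star_cvg_closed_lt cT wmu cW hW'.
move: nW; apply: filterS2 => j h1 h2.
have mb : measurable (bad f d j : set (Borel T)) by exact: measurable_bad.
rewrite (splitr e) EFinD; apply: le_lt_trans (lteD h1 h2).
rewrite (_ : 4 * (d / 4) = d); last by field.
have mbW := measurableI _ _ mb mWB; have mWC := measurableC mWB.
apply: le_trans (measureU2 _ mbW mWC).
apply: le_measure; rewrite ?inE//.
  exact: measurableU.
by move=> x bx; have [Wx|] := pselect (W x); [left|right].
Qed.

End StrongLimits.

(** * Error made by replacing one factor of a product *)

Section GenericEstimates.
Context d (X : measurableType d) (R : realType) (m : {measure set X -> \bar R}).
Implicit Types (D E : set X) (f h a b psi : X -> R).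

(** Plays for [psi_], known only to be integrable, the role that [Rintegral_norm_le_powR] plays for
    [psi j]. *)
Lemma Rintegral_absolutely_continuous D f : measurable D ->
  m.-integrable D (EFin \o f) -> forall e : R, 0 < e -> exists2 eta : R, 0 < eta &
  forall E, measurable E -> (m (D `&` E) < eta%:E)%E ->
    \int[m]_(x in D `&` E) `|f x| < e.
Proof.
move=> mD iF e e0; pose g := f \_ D.
have ig : m.-integrable setT (EFin \o g).
  rewrite -restrict_EFin.
  exact: ((@integrable_mkcond _ _ _ m _ (EFin \o f) mD).1 iF).
have [eta [eta0 H]] := integral_normr_continuous ig e0.
exists eta => // E mE /(H _ (measurableI _ _ mD mE)); congr (_ < _).
by apply: eq_Rintegral => x; rewrite inE => -[Dx _]; rewrite /g patchE mem_set.
Qed.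

(** Meant for [a] the truncated G of [phi j] or [phistar] and [b] that of [f]. The two products are
    bracketed differently because [h * b] will be a continuous test function for [psi]. *)
Lemma Rintegral_diff_le D E psi h a b (H M w : R) : measurable D -> measurable E ->
  m.-integrable D (EFin \o psi) ->
  measurable_fun D h -> measurable_fun D a -> measurable_fun D b ->
  0 <= H -> 0 <= M -> 0 <= w ->
  (forall x, D x -> `|h x| <= H) -> (forall x, D x -> `|a x| <= M) ->
  (forall x, D x -> `|b x| <= M) ->
  (forall x, D x -> ~ E x -> `|a x - b x| <= w) ->
  `|\int[m]_(x in D) (h x * (a x * psi x)) - \int[m]_(x in D) (h x * b x * psi x)| <=
  H * w * \int[m]_(x in D) `|psi x| + H * (M + M) * \int[m]_(x in D `&` E) `|psi x|.
Proof.
move=> mD mE ip mh ma mb H0 M0 w0 hH aM bM abw.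
have iap : m.-integrable D (EFin \o (fun x => h x * (a x * psi x))).
  by apply: (integrableM_bounded mD mh hH); exact: (integrableM_bounded mD ma aM).
have ibp : m.-integrable D (EFin \o (fun x => h x * b x * psi x)).
  apply: (integrableM_bounded mD (measurable_funM mh mb) (M := H * M)) => // x Dx.
  by rewrite normrM ler_pM// ?hH ?bM.
rewrite -RintegralB//.
have -> : \int[m]_(x in D) (h x * (a x * psi x) - h x * b x * psi x) =
    \int[m]_(x in D) ((h x * (a x - b x)) * psi x).
  by apply: eq_Rintegral => x _; ring.
apply: Rintegral_mul_le => //.
- by apply: measurable_funM => //; exact: measurable_funB.
- exact: mulr_ge0.
- by rewrite mulr_ge0// addr_ge0.
- move=> x Dx; rewrite normrM ler_pM ?hH//.
  by rewrite (le_trans (ler_normB _ _))// lerD ?aM ?bM.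
- by move=> x Dx Ex; rewrite normrM ler_pM ?hH ?abw.
Qed.

End GenericEstimates.

(** * Passage to the limit in truncated products *)

Section WeakStrong.
Context {R : realType} {T : pointedMetricType R}.
Variables (mu_ : nat -> {finite_measure set (Borel T) -> \bar R})
  (mu : {finite_measure set (Borel T) -> \bar R})
  (phi : nat -> T -> R) (phistar : T -> R).
Hypothesis cT : compact [set: T].
Hypothesis wmu : weak_star_cvg mu_ mu.
Hypothesis mphi : is_sequence mu_ phi.
Hypothesis sphi : strong_limit_values mu_ mu phi phistar.
Variables (psi : nat -> T -> R) (psi_ : T -> R) (r B : R).
Hypothesis mpsi : is_sequence mu_ psi.
Hypothesis r1 : 1 < r.
Hypothesis bpsi : \forall j \near \oo,
  (mu_ j).-integrable (supp (mu_ j)) (EFin \o (fun x => `|psi j x| `^ r)) /\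
  \int[mu_ j]_(x in supp (mu_ j)) (`|psi j x| `^ r) <= B.
Hypothesis wpsi : weak_limit_values mu_ mu psi psi_.

Local Notation nu := (completion mu).

(** The whole space is closed, so the portmanteau inequality bounds its [mu_ j]-measure by mu(K) + 1
    for large [j]. *)
Lemma mass_bounded : exists2 V : R, 0 < V &
  \forall j \near \oo, fine (mu_ j (supp (mu_ j))) <= V.
Proof.
have muT : mu setT \is a fin_num by exact: fin_num_measure.
exists (fine (mu setT) + 1); first by rewrite ltr_wpDl// fine_ge0.
have : (mu setT < (fine (mu setT) + 1)%:E)%E.
  by rewrite -(fineK muT) lte_fin /= ltrDl.
move=> /(weak_star_cvg_closed_lt cT wmu closedT); apply: filterS => j h.
have mS := measurable_supp (mu_ j).
rewrite -lee_fin fineK; last exact: fin_num_measure.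
by rewrite (le_trans _ (ltW h))//; apply: le_measure; rewrite ?inE.
Qed.

(** Integrates |psi| <= 1 + |psi|^r, the splitting at level 1, against measures of bounded mass. *)
Lemma psi_L1_bounded : exists2 V : R, 0 < V & \forall j \near \oo,
  (mu_ j).-integrable (supp (mu_ j)) (EFin \o psi j) /\
  \int[mu_ j]_(x in supp (mu_ j)) `|psi j x| <= V.
Proof.
have [V V0 hV] := mass_bounded.
exists (V + `|B|); first by rewrite ltr_wpDr.
near=> j; have mS := measurable_supp (mu_ j).
have [ir rB] : (mu_ j).-integrable (supp (mu_ j)) (EFin \o (fun x => `|psi j x| `^ r)) /\
  \int[mu_ j]_(x in supp (mu_ j)) (`|psi j x| `^ r) <= B by near: j.
have mV : fine (mu_ j (supp (mu_ j))) <= V by near: j.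
have lty := finite_measure_lty (mu_ j) mS.
have ic : (mu_ j).-integrable (supp (mu_ j)) (EFin \o cst (1 : R)).
  exact: finite_measure_integrable_cst.
split.
  have i1 : (mu_ j).-integrable (supp (mu_ j)) (EFin \o (fun x => 1 + `|psi j x| `^ r)).
    exact: (integrableD mS ic ir).
  apply: (le_integrableR mS (@mpsi j) _ i1) => x _.
  have := le_truncD_powR (ltW r1) (@ltr01 R) (normr_ge0 (psi j x)).
  by rewrite powR1 mul1r.
have := Rintegral_norm_le_powR mS measurableT lty (@mpsi j) (ltW r1) (@ltr01 R) ir.
rewrite setIT powR1 !mul1r => /le_trans; apply; apply: lerD => //.
exact: le_trans rB (ler_norm _).
Unshelve. all: by end_near. Qed.

Lemma weak_limit_Rintegral (h : T -> R) : continuous h ->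
  \int[mu_ j]_(x in supp (mu_ j)) (h x * psi j x) @[j --> \oo] -->
  \int[nu]_(x in supp mu) (h x * psi_ x).
Proof.
move=> ch; have [ip cw] := wpsi; have mS := measurable_supp_completion mu.
have [H [_ hH]] := continuous_norm_bounded cT ch.
apply: fine_cvg; rewrite fineK; first exact: cw.
apply: integrable_fin_num => //.
apply: (integrableM_bounded mS _ (fun x _ => hH x) ip).
exact: continuous_measurable_completion.
Qed.

(** For fixed [N] the function [G (clamp N t)] of t is bounded and uniformly continuous, so an [f]
    close in measure suffices. On the bad sets [psi j] is controlled by its r-th powers and [psi_]
    by absolute continuity of its integral. *)
Lemma cvg_Rintegral_clamp (G : R -> R) (N : R) (h : T -> R) : 0 <= N ->
  continuous G -> continuous h ->
  \int[mu_ j]_(x in supp (mu_ j)) (h x * (G (clamp N (phi j x)) * psi j x)) @[j --> \oo] -->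
  \int[nu]_(x in supp mu) (h x * (G (clamp N (phistar x)) * psi_ x)).
Proof.
move=> N0 cG ch; apply: cvg_uniform_approx => e e0.
have [ip _] := wpsi; have mS := measurable_supp_completion mu.
have [mphistar _] := sphi.
have [H [H0 hH]] := continuous_norm_bounded cT ch.
have [M [M0 hM]] := continuous_clamp_bounded N0 cG.
have [V V0 hV] := psi_L1_bounded.
pose I := \int[nu]_(x in supp mu) `|psi_ x|.
have I0 : 0 <= I by apply: Rintegral_ge0 => x _.
pose M2 := H * (M + M).
have M20 : 0 < M2 by rewrite mulr_gt0// addr_gt0.
(* The oscillation allowed off the bad sets; with V + I in the denominator one value serves both the
   sequence and the limit. *)
pose w := e / (2 * (H * (V + I))).
have VI : 0 < V + I by rewrite ltr_wpDr.
have w0 : 0 < w by rewrite divr_gt0// !mulr_gt0.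
have wV : H * w * V <= e / 2.
  have -> : H * w * V = e / 2 * (V / (V + I)).
    by rewrite /w; field; rewrite ?gt_eqF.
  by rewrite ler_piMr ?divr_ge0 ?(ltW e0)// ler_pdivrMr// mul1r lerDl.
have wI : H * w * I <= e / 2.
  have -> : H * w * I = e / 2 * (I / (V + I)).
    by rewrite /w; field; rewrite ?gt_eqF.
  by rewrite ler_piMr ?divr_ge0 ?(ltW e0)// ler_pdivrMr// mul1r lerDr ltW.
have [dl dl0 hdl] := continuous_clamp_unif N0 cG w0.
have four0 : 0 < 4 :> R by rewrite ltr0n.
have B0 : 0 < `|B| + 1 by rewrite ltr_wpDl.
(* [L] is fixed before [eta]: this bound on L^(1 - r) makes M2 L^(1 - r) (|B| + 1) at most e / 4,
   and eta <= e / (4 M2 L) then makes M2 L eta at most e / 4. *)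
have e1 : 0 < e / (4 * M2 * (`|B| + 1)).
  exact: divr_gt0 e0 (mulr_gt0 (mulr_gt0 four0 M20) B0).
have r10 : 0 < r - 1 by rewrite subr_gt0.
have [n _ /(_ n (leqnn n)) hn] := powR_nat_cvg0 r10 e1.
pose L : R := n.+1%:R; have L0 : 0 < L by rewrite ltr0n.
have e2 : 0 < e / (2 * M2) by exact: divr_gt0 e0 (mulr_gt0 (ltr0Sn _ _) M20).
have [eta2 eta20 heta2] := Rintegral_absolutely_continuous mS ip e2.
pose eta := Num.min (e / (4 * M2 * L)) eta2.
have eta0 : 0 < eta by rewrite lt_min eta20 andbT (divr_gt0 e0 (mulr_gt0 (mulr_gt0 four0 M20) L0)).
have [f [cf hf1 hf2]] := strong_limit_cvg_measure cT wmu mphi sphi dl0 eta0.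
have cGf : continuous (fun x => G (clamp N (f x))).
  move=> x; apply: (@continuous_comp _ _ _ (fun x => clamp N (f x)) G).
    by apply: (@continuous_comp _ _ _ f (clamp N)); [exact: cf|exact: clamp_continuous].
  exact: cG.
have chG : continuous (fun x => h x * G (clamp N (f x))).
  by move=> x; apply: continuousM; [exact: ch|exact: cGf].
have cGN : continuous (fun t => G (clamp N t)).
  by move=> t; apply: (@continuous_comp _ _ _ (clamp N) G);
    [exact: clamp_continuous|exact: cG].
exists (fun j => \int[mu_ j]_(x in supp (mu_ j)) (h x * G (clamp N (f x)) * psi j x)).
exists (\int[nu]_(x in supp mu) (h x * G (clamp N (f x)) * psi_ x)).
split.
- exact: weak_limit_Rintegral.
- rewrite distrC.
  have mE : measurable (supp mu `&` [set x | dl <= `|f x - phistar x|] : set (Mmeas mu)).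
    have mf : @measurable_fun _ _ (Mmeas mu) R (supp mu) f.
      exact: continuous_measurable_completion.
    exact: (measurable_ge_norm _ mS (measurable_funB mf mphistar)).
  have mh : @measurable_fun _ _ (Mmeas mu) R (supp mu) h.
    exact: continuous_measurable_completion.
  have mb : @measurable_fun _ _ (Mmeas mu) R (supp mu) (fun x => G (clamp N (f x))).
    exact: continuous_measurable_completion.
  have ma := measurable_continuous_comp cGN mphistar.
  apply: (le_trans (Rintegral_diff_le mS mE ip mh ma mb (ltW H0) (ltW M0) (ltW w0)
    (fun x _ => hH x) (fun x _ => hM _) (fun x _ => hM _) _)).
    move=> x Sx nE; apply: hdl; rewrite leNgt distrC; apply/negP => /ltW dx.
    by apply: nE.
  have hE : \int[nu]_(x in supp mu `&` (supp mu `&` [set x | dl <= `|f x - phistar x|]))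
      `|psi_ x| < e / (2 * M2).
    apply: heta2 => //; rewrite setIA setIid.
    by apply: lt_le_trans hf1 _; rewrite lee_fin ge_min lexx orbT.
  rewrite [leRHS]splitr; apply: lerD; first exact: wI.
  rewrite (le_trans (ler_wpM2l (ltW M20) (ltW hE)))//.
  by rewrite le_eqVlt; apply/orP; left; apply/eqP; field; rewrite ?gt_eqF.
move: hf2 hV bpsi; apply: filterS3 => j hf2 [ipj hVj] [irj hBj].
have mSj := measurable_supp (mu_ j).
have mE := measurable_bad mphi dl j cf.
have mh : @measurable_fun _ _ (Borel T) R (supp (mu_ j)) h.
  exact: continuous_measurable_Borel.
have mb : @measurable_fun _ _ (Borel T) R (supp (mu_ j)) (fun x => G (clamp N (f x))).
  exact: continuous_measurable_Borel.
have ma := measurable_continuous_comp cGN (@mphi j).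
apply: (le_trans (Rintegral_diff_le mSj mE ipj mh ma mb (ltW H0) (ltW M0) (ltW w0)
    (fun x _ => hH x) (fun x _ => hM _) (fun x _ => hM _) _)).
  move=> x Sx nE; apply: hdl; rewrite leNgt; apply/negP => /ltW dx.
  by apply: nE.
have lty := finite_measure_lty (mu_ j) mSj.
have := Rintegral_norm_le_powR mSj mE lty (@mpsi j) (ltW r1) L0 irj.
rewrite setIA setIid => hE.
rewrite [leRHS]splitr; apply: lerD.
  by rewrite (le_trans _ wV)// ler_wpM2l// mulr_ge0 ?ltW.
rewrite (le_trans (ler_wpM2l (ltW M20) hE))// mulrDr.
rewrite (_ : e / 2 = e / 4 + e / 4); last by field.
apply: lerD.
  have hb : fine (mu_ j (supp (mu_ j) `&` [set x | dl <= `|phi j x - f x|])) <= e / (4 * M2 * L).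
    rewrite -lee_fin fineK; last exact: fin_num_measure.
    by rewrite (le_trans (ltW hf2))// lee_fin ge_min lexx.
  rewrite (le_trans (ler_wpM2l (ltW M20) (ler_wpM2l (ltW L0) hb)))//.
  by rewrite le_eqVlt; apply/orP; left; apply/eqP; field; rewrite ?gt_eqF.
have hL : L `^ (1 - r) <= e / (4 * M2 * (`|B| + 1)) by rewrite -(opprB r 1).
have hB : \int[mu_ j]_(x in supp (mu_ j)) (`|psi j x| `^ r) <= `|B| + 1.
  by rewrite (le_trans hBj)// (le_trans (ler_norm _))// lerDl.
rewrite (le_trans (ler_wpM2l (ltW M20) (ler_pM _ _ hL hB)))//.
- exact: powR_ge0.
- by apply: Rintegral_ge0 => x _; exact: powR_ge0.
by rewrite le_eqVlt; apply/orP; left; apply/eqP; field; rewrite ?gt_eqF.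
Qed.

End WeakStrong.

(** * Tail estimates for powers *)

Section PowerFunctions.
Context {R : realType}.

Lemma continuous_norm_powR (p : R) : 1 <= p -> continuous (fun t : R => `|t| `^ p).
Proof.
move=> p1 t; have p0 : 0 < p by exact: lt_le_trans p1.
(* Away from 0 continuity comes from differentiability of the power at a positive base; at 0 it
   comes from |u|^p <= |u| for |u| <= 1. *)
have [->|t0] := eqVneq t 0.
  rewrite /continuous_at normr0 powR0 ?gt_eqF//.
  apply/cvgr0Pnorm_le => e e0; near=> u.
  rewrite ger0_norm ?powR_ge0//.
  have u1 : `|u| <= Num.min e 1.
    near: u; have /cvgr0Pnorm_le : id z @[z --> (0 : R)] --> (0 : R) by exact: cvg_id.
    by apply; rewrite lt_min e0 ltr01.
  move: u1; rewrite le_min => /andP[ue u1]; apply: le_trans ue.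
  have [->|u0] := eqVneq u 0; first by rewrite normr0 powR0 ?gt_eqF.
  by apply: ge1r_powR => //; rewrite normr_gt0 u0.
have nt : 0 < `|t| by rewrite normr_gt0.
apply: (@continuous_comp _ _ _ (fun u : R => `|u|) (fun u : R => u `^ p)).
  exact: norm_continuous.
apply/differentiable_continuous/derivable1_diffP.
by apply: derivable_powR; rewrite in_itv/= nt.
Unshelve. all: by end_near. Qed.

(** The left side vanishes unless |t| > N, and then |t|^s = |t|^(s - p) |t|^p <= N^(s - p) |t|^p.
    The factor tends to 0 as N grows when s < p, but is 1 when s = p. *)
Lemma norm_powR_clamp_diff (N s p t : R) : 0 < N -> 0 <= s -> s <= p ->
  `| `|t| `^ s - `|clamp N t| `^ s| <= N `^ (- (p - s)) * `|t| `^ p.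
Proof.
move=> N0 s0 sp; have [tN|/ltW Nt] := leP `|t| N.
  by rewrite clamp_id// subrr normr0 mulr_ge0// powR_ge0.
have t0 : 0 < `|t| by exact: lt_le_trans N0 Nt.
rewrite ger0_norm ?subr_ge0; last first.
  by rewrite ge0_ler_powR ?nnegrE// norm_clamp_le// ltW.
apply: (@le_trans _ _ (`|t| `^ s)); first by rewrite gerBl powR_ge0.
rewrite powRN ler_pdivlMl ?powR_gt0//.
apply: (@le_trans _ _ (`|t| `^ (p - s) * `|t| `^ s)).
  by rewrite ler_wpM2r ?powR_ge0// ge0_ler_powR ?nnegrE ?subr_ge0// ltW.
by rewrite -powRD ?subrK// (gt_eqF t0) implybT.
Qed.

(* The case distinction [u <= d t^(p-1)] replaces Young's inequality; it is where
   [q < s] enters. *)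
Lemma clamp_diff_mul_le (p q s d : R) : 1 < p -> p^-1 + q^-1 = 1 -> q < s -> 0 < d ->
  \forall n \near \oo, forall t u : R,
    `|t - clamp n.+1%:R t| * `|u| <= d * (`|t| `^ p + `|u| `^ s).
Proof.
move=> p1 pq qs d0.
have p0 : 0 < p by exact: lt_trans p1.
have p10 : 0 < p - 1 by rewrite subr_gt0.
(* This relation turns |t| |u|, with |t| <= (|u| / d)^(1 / (p - 1)), into a multiple of |u|^q. *)
have qE : q = 1 + (p - 1)^-1.
  have q1 : q^-1 = (p - 1) / p by rewrite mulrBl divff ?gt_eqF// mul1r -pq addrC addKr.
  by rewrite -[LHS]invrK q1; field; rewrite ?gt_eqF.
have sq : 0 < s - q by rewrite subr_gt0.
have a0 : 0 < (p - 1) * (s - q) by rewrite mulr_gt0.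
(* In the second case |u| >= d N^(p - 1), so writing |u|^q = |u|^s |u|^(-(s - q)) bounds |t| |u| by
   c N^(-(p - 1)(s - q)) |u|^s; [N] is taken so large that this coefficient is at most [d]. *)
pose c := d `^ (- (p - 1)^-1) * d `^ (- (s - q)).
have c0 : 0 < c by rewrite mulr_gt0// powR_gt0.
near=> n => t u.
have hn : (n.+1%:R : R) `^ (- ((p - 1) * (s - q))) <= d / c.
  by near: n; apply: powR_nat_cvg0 => //; rewrite divr_gt0.
set N : R := n.+1%:R in hn *.
have N0 : 0 < N by rewrite ltr0n.
have [tN|/ltW Nt] := leP `|t| N.
  by rewrite clamp_id// subrr normr0 mul0r mulr_ge0 ?addr_ge0 ?powR_ge0// ltW.
have t0 : 0 < `|t| by exact: lt_le_trans N0 Nt.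
have dt : `|t - clamp N t| <= `|t|.
  have N0' := ltW N0; rewrite /clamp; move: Nt.
  case: (leP t N) => h1; case: (leP (- N) _) => h2; have [t1|t1] := leP 0 t;
    rewrite ?(ger0_norm t1) ?(ltr0_norm t1) => Nt; rewrite ler_norml; apply/andP; split; lra.
apply: (le_trans (ler_wpM2r (normr_ge0 u) dt)).
have tp : `|t| `^ p = `|t| * `|t| `^ (p - 1).
  rewrite -{2}(powRr1 (ltW t0)) -powRD ?(gt_eqF t0) ?implybT//.
  by congr (_ `^ _); ring.
have [ut|/ltW tu] := leP `|u| (d * `|t| `^ (p - 1)).
  rewrite mulrDr tp (le_trans (ler_wpM2l (ltW t0) ut))//.
  by rewrite mulrCA lerDl mulr_ge0 ?powR_ge0// ltW.
have u0 : 0 < `|u| by apply: lt_le_trans tu; rewrite mulr_gt0// powR_gt0.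
have t_le : `|t| <= (`|u| / d) `^ (p - 1)^-1.
  have -> : `|t| = (`|t| `^ (p - 1)) `^ (p - 1)^-1.
    by rewrite -powRrM mulfV ?gt_eqF// powRr1// ltW.
  rewrite ge0_ler_powR ?nnegrE ?powR_ge0 ?divr_ge0 ?invr_ge0 ?(ltW p10) ?(ltW d0)//.
  by rewrite ler_pdivlMr// mulrC.
have uN : d * N `^ (p - 1) <= `|u|.
  apply: le_trans tu; rewrite ler_wpM2l ?(ltW d0)//.
  by rewrite ge0_ler_powR ?nnegrE ?(ltW p10) ?(ltW N0) ?(ltW t0).
have us : `|u| `^ q = `|u| `^ s * `|u| `^ (- (s - q)).
  rewrite -powRD ?(gt_eqF u0) ?implybT//; congr (_ `^ _); ring.
have um : `|u| `^ (- (s - q)) <= (d * N `^ (p - 1)) `^ (- (s - q)).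
  rewrite !powRN lef_pV2 ?posrE ?powR_gt0// ?mulr_gt0// ?powR_gt0//.
  by rewrite ge0_ler_powR ?nnegrE ?(ltW sq) ?(ltW u0)// mulr_ge0 ?powR_ge0// ltW.
have key : `|t| * `|u| <= d `^ (- (p - 1)^-1) * `|u| `^ q.
  rewrite (le_trans (ler_wpM2r (ltW u0) t_le))//.
  rewrite powRM ?invr_ge0 ?(ltW d0) ?(ltW u0)// -(@powR_inv1 _ d) ?(ltW d0)// -powRrM mulN1r.
  rewrite mulrAC mulrC ler_wpM2l ?powR_ge0//.
  by rewrite qE [1 + _]addrC powRD ?(gt_eqF u0) ?implybT// powRr1 ?(ltW u0).
apply: (le_trans key); rewrite us mulrDr.
apply: (@le_trans _ _ (d * `|u| `^ s)); last first.
  by rewrite lerDr mulr_ge0 ?powR_ge0// ltW.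
rewrite mulrCA mulrC ler_wpM2r ?powR_ge0//.
rewrite (le_trans (ler_wpM2l _ um)) ?powR_ge0//.
rewrite powRM ?powR_ge0 ?(ltW d0)// -powRrM mulrA -/c mulrN.
by rewrite -ler_pdivlMl// [leRHS]mulrC.
Unshelve. all: by end_near. Qed.

End PowerFunctions.

(** * Removal of the truncation *)

Section LowerSemicontinuity.
Context {R : realType} {T : pointedMetricType R}.
Variables (mu_ : nat -> {finite_measure set (Borel T) -> \bar R})
  (mu : {finite_measure set (Borel T) -> \bar R})
  (phi : nat -> T -> R) (phistar : T -> R).
Hypothesis cT : compact [set: T].
Hypothesis wmu : weak_star_cvg mu_ mu.
Hypothesis mphi : is_sequence mu_ phi.
Hypothesis sphi : strong_limit_values mu_ mu phi phistar.
Variables (psi : nat -> T -> R) (psi_ : T -> R) (r B : R).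
Hypothesis mpsi : is_sequence mu_ psi.
Hypothesis r1 : 1 < r.
Hypothesis bpsi : \forall j \near \oo,
  (mu_ j).-integrable (supp (mu_ j)) (EFin \o (fun x => `|psi j x| `^ r)) /\
  \int[mu_ j]_(x in supp (mu_ j)) (`|psi j x| `^ r) <= B.
Hypothesis wpsi : weak_limit_values mu_ mu psi psi_.
Variable G : R -> R.
Hypothesis cG : continuous G.
Hypothesis Gclamp : forall N t, 0 <= N -> `|G (clamp N t)| <= `|G t|.

Local Notation nu := (completion mu).

(** Truncation makes [F n] integrable, as duality requires. By [Gclamp] the same [C] bounds every
    [F n], so the bound survives Fatou's lemma. *)
Lemma integral_strong_weak_le (C : R) :
  (\forall j \near \oo,
    (mu_ j).-integrable (supp (mu_ j)) (EFin \o (fun x => G (phi j x) * psi j x)) /\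
    \int[mu_ j]_(x in supp (mu_ j)) `|G (phi j x) * psi j x| <= C) ->
  (\int[nu]_(x in supp mu) `|G (phistar x) * psi_ x|%:E <= C%:E)%E.
Proof.
move=> hC; have [ip _] := wpsi; have mS := measurable_supp_completion mu.
have [mphistar _] := sphi.
have cGN (N : R) : continuous (fun t => G (clamp N t)).
  by move=> t; apply: (@continuous_comp _ _ _ (clamp N) G);
    [exact: clamp_continuous|exact: cG].
pose F (n : nat) x := G (clamp n%:R (phistar x)) * psi_ x.
have iF n : nu.-integrable (supp mu) (EFin \o F n).
  have [M [_ hM]] := continuous_clamp_bounded (ler0n R n) cG.
  exact: (integrableM_bounded mS (measurable_continuous_comp (@cGN n%:R) mphistar)
    (fun x _ => hM _) ip).
have FC n : \int[nu]_(x in supp mu) `|F n x| <= C.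
  apply: (Rintegral_norm_le_dual cT (iF n)) => h ch h1.
  have cv := cvg_Rintegral_clamp cT wmu mphi sphi mpsi r1 bpsi wpsi (ler0n R n) cG ch.
  apply: (cvgr_to_le (cvg_norm cv)).
  move: hC; apply: filterS => j [ij hj].
  have mSj := measurable_supp (mu_ j).
  have mh : @measurable_fun _ _ (Borel T) R (supp (mu_ j)) h.
    exact: continuous_measurable_Borel.
  have mc : @measurable_fun _ _ (Borel T) R (supp (mu_ j))
      (fun x => h x * (G (clamp n%:R (phi j x)) * psi j x)).
    apply: (measurable_funM mh); apply: (measurable_funM _ (@mpsi j)).
    exact: (measurable_continuous_comp (@cGN n%:R) (@mphi j)).
  have hb x : supp (mu_ j) x -> `|h x * (G (clamp n%:R (phi j x)) * psi j x)| <=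
      `|G (phi j x) * psi j x|.
    move=> _; rewrite !normrM -[leRHS]mul1r ler_pM ?h1 ?mulr_ge0//.
    by rewrite ler_wpM2r// Gclamp.
  have ic := le_integrableR mSj mc hb (integrable_norm ij).
  rewrite (le_trans (le_normr_Rintegral mSj ic))// (le_trans _ hj)//.
  by apply: le_Rintegral => //; exact: integrable_norm.
have mnF n : @measurable_fun _ _ (Mmeas mu) _ (supp mu) (fun x => `|F n x|%:E).
  exact: (measurable_int _ (integrable_norm (iF n))).
have F0 n x : supp mu x -> (0 <= `|F n x|%:E)%E by rewrite lee_fin.
have := fatou nu mS mnF F0.
(* Since [phistar] is real-valued, the sequence is eventually constant at each point. *)
have FE x : limn_einf (fun n => `|F n x|%:E) = `|G (phistar x) * psi_ x|%:E.
  have cv : (`|F n x|%:E @[n --> \oo] --> `|G (phistar x) * psi_ x|%:E)%E.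
    apply: cvg_near_cst; near=> n; congr (`|G _ * _|%:E).
    apply: clamp_id; near: n; exact: nbhs_infty_ger.
  by rewrite (cvg_limn_einf_sup cv).1.
under eq_integral do rewrite FE.
move=> /le_trans; apply; apply: le_trans (limn_einf_sup _) _.
apply: (@le_trans _ _ (ereal_sup (range (fun n => (\int[nu]_(x in supp mu) `|F n x|%:E)%E)))).
  by apply: ereal_inf_lbound; exists setT => //; exact: filterT.
apply: ub_ereal_sup => _ [n _ <-].
rewrite -[leLHS]fineK ?lee_fin ?FC//.
exact: (integrable_fin_num mS (integrable_norm (iF n))).
Unshelve. all: by end_near. Qed.

(** The tail hypothesis serves twice: with d = 1 it bounds the products uniformly in L^1, which
    makes the limit integrable; with small [d] it makes the truncation error small uniformly in
    [j]. *)
Lemma cvg_integral_strong_weak (p A : R) (h : T -> R) :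
  (\forall j \near \oo,
    (mu_ j).-integrable (supp (mu_ j)) (EFin \o (fun x => `|phi j x| `^ p)) /\
    \int[mu_ j]_(x in supp (mu_ j)) (`|phi j x| `^ p) <= A) ->
  (forall d : R, 0 < d -> \forall n \near \oo, forall j x,
    `|G (phi j x) - G (clamp n.+1%:R (phi j x))| * `|psi j x| <=
    d * (`|phi j x| `^ p + `|psi j x| `^ r)) ->
  continuous h ->
  (fun j => (\int[mu_ j]_(x in supp (mu_ j)) (h x * (G (phi j x) * psi j x))%:E)%E)
    @ \oo --> (\int[nu]_(x in supp mu) (h x * (G (phistar x) * psi_ x))%:E)%E.
Proof.
move=> hA tail ch; have [ip _] := wpsi; have mS := measurable_supp_completion mu.
have [mphistar _] := sphi.
have mpsi_ : @measurable_fun _ _ (Mmeas mu) R (supp mu) psi_.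
  exact/measurable_EFinP/(measurable_int _ ip).
have cGN (N : R) : continuous (fun t => G (clamp N t)).
  by move=> t; apply: (@continuous_comp _ _ _ (clamp N) G);
    [exact: clamp_continuous|exact: cG].
have mGpsi j : @measurable_fun _ _ (Borel T) R (supp (mu_ j))
    (fun x => G (phi j x) * psi j x).
  exact: (measurable_funM (measurable_continuous_comp cG (@mphi j)) (@mpsi j)).
have [H [H0 hH]] := continuous_norm_bounded cT ch.
have [V V0 hV] := psi_L1_bounded cT wmu mpsi r1 bpsi.
(* At this level |G(phi_j) psi_j| <= M |psi_j| + |phi_j|^p + |psi_j|^r. *)
have [n0 _ /(_ n0 (leqnn n0)) tail1] := tail 1 ltr01.
have [M [M0 hM]] := continuous_clamp_bounded (ler0n R n0.+1) cG.
have hC : \forall j \near \oo,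
    (mu_ j).-integrable (supp (mu_ j)) (EFin \o (fun x => G (phi j x) * psi j x)) /\
    \int[mu_ j]_(x in supp (mu_ j)) `|G (phi j x) * psi j x| <= M * V + (A + B).
  move: hA hV bpsi; apply: filterS3 => j [ipj hpj] [ij hj] [irj hrj].
  have mSj := measurable_supp (mu_ j).
  have iM := integrableZl mSj M (integrable_norm ij).
  have ib : (mu_ j).-integrable (supp (mu_ j))
      (EFin \o (fun x => M * `|psi j x| + (`|phi j x| `^ p + `|psi j x| `^ r))).
    exact: (integrableD mSj iM (integrableD mSj ipj irj)).
  have le_b x : `|G (phi j x) * psi j x| <=
      M * `|psi j x| + (`|phi j x| `^ p + `|psi j x| `^ r).
    rewrite normrM.
    have hG : `|G (phi j x)| <= M + `|G (phi j x) - G (clamp n0.+1%:R (phi j x))|.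
      rewrite -lerBlDr; apply: le_trans (hM (phi j x)).
      by rewrite lerBlDr -lerBlDl lerB_dist.
    rewrite (le_trans (ler_wpM2r (normr_ge0 _) hG))// mulrDl lerD2l.
    by have := tail1 j x; rewrite mul1r.
  have iG := le_integrableR mSj (mGpsi j) (fun x _ => le_b x) ib.
  split=> //; apply: (le_trans (le_Rintegral mSj (integrable_norm iG) ib (fun x _ => le_b x))).
  rewrite RintegralD//; last exact: (integrableD mSj ipj irj).
  rewrite RintegralZl//; last exact: (integrable_norm ij).
  by rewrite RintegralD// lerD ?lerD// ler_wpM2l// ltW.
have intC := integral_strong_weak_le hC.
have mG : @measurable_fun _ _ (Mmeas mu) R (supp mu) (fun x => G (phistar x) * psi_ x).
  exact: (measurable_funM (measurable_continuous_comp cG mphistar) mpsi_).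
have iG : nu.-integrable (supp mu) (EFin \o (fun x => G (phistar x) * psi_ x)).
  apply/integrableP; split; first exact/measurable_EFinP.
  exact: le_lt_trans intC (ltry _).
have mh : @measurable_fun _ _ (Mmeas mu) R (supp mu) h.
  exact: continuous_measurable_completion.
have ihG := integrableM_bounded mS mh (fun x _ => hH x) iG.
rewrite -[X in _ --> X]fineK; last exact: (integrable_fin_num mS ihG).
have hhC : \forall j \near \oo, (mu_ j).-integrable (supp (mu_ j))
    (EFin \o (fun x => h x * (G (phi j x) * psi j x))).
  move: hC; apply: filterS => j [ij _].
  have mhj : @measurable_fun _ _ (Borel T) R (supp (mu_ j)) h.
    exact: continuous_measurable_Borel.
  exact: (integrableM_bounded (measurable_supp (mu_ j)) mhj (fun x _ => hH x) ij).
apply/fine_cvgP; split.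
  move: hhC; apply: filterS => j ij.
  exact: (integrable_fin_num (measurable_supp (mu_ j)) ij).
apply: cvg_uniform_approx => e e0.
have AB0 : 0 < `|A| + `|B| + 1 by rewrite ltr_wpDl// addr_ge0.
(* Makes H d (A + B) at most [e]; the absolute values and the + 1 avoid any assumption on the signs
   of [A] and [B]. *)
have d0 : 0 < e / (H * (`|A| + `|B| + 1)) by rewrite divr_gt0 ?mulr_gt0.
have cvm : \int[nu]_(x in supp mu) (h x * (G (clamp n.+1%:R (phistar x)) * psi_ x))
    @[n --> \oo] --> \int[nu]_(x in supp mu) (h x * (G (phistar x) * psi_ x)).
  have ig := integrableZl mS H (integrable_norm iG).
  have mF n : @measurable_fun _ _ (Mmeas mu) R (supp mu)
      (fun x => h x * (G (clamp n.+1%:R (phistar x)) * psi_ x)).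
    apply: (measurable_funM mh); apply: (measurable_funM _ mpsi_).
    exact: (measurable_continuous_comp (@cGN n.+1%:R) mphistar).
  have mhG := measurable_funM mh mG.
  have [] := integrable_cvg_Rintegral mS mF mhG _ ig _; last by [].
    move=> n x _; rewrite /= !normrM ler_pM ?hH ?mulr_ge0//.
    by rewrite ler_wpM2r// Gclamp.
  move=> x _; apply: cvg_near_cst; near=> n; congr (_ * (G _ * _)).
  apply: clamp_id; apply: (@le_trans _ _ n%:R); last by rewrite ler_nat.
  by near: n; exact: nbhs_infty_ger.
have /cvgrPdist_le/(_ _ e0) cvme := cvm.
(* A single level [n] has to serve the tails of the sequence and the truncation of the limit. *)
have [n [tn mn]] : exists n : nat, (forall j x,
    `|G (phi j x) - G (clamp n.+1%:R (phi j x))| * `|psi j x| <=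
    e / (H * (`|A| + `|B| + 1)) * (`|phi j x| `^ p + `|psi j x| `^ r)) /\
  `|\int[nu]_(x in supp mu) (h x * (G (phistar x) * psi_ x)) -
    \int[nu]_(x in supp mu) (h x * (G (clamp n.+1%:R (phistar x)) * psi_ x))| <= e.
  by have [n Hn] := filter_ex (filterI (tail _ d0) cvme); exists n.
exists (fun j => \int[mu_ j]_(x in supp (mu_ j))
  (h x * (G (clamp n.+1%:R (phi j x)) * psi j x))).
exists (\int[nu]_(x in supp mu) (h x * (G (clamp n.+1%:R (phistar x)) * psi_ x))).
split; last first.
- near=> j.
  have [ipj hpj] : (mu_ j).-integrable (supp (mu_ j)) (EFin \o (fun x => `|phi j x| `^ p)) /\
    \int[mu_ j]_(x in supp (mu_ j)) (`|phi j x| `^ p) <= A by near: j.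
  have [irj hrj] : (mu_ j).-integrable (supp (mu_ j)) (EFin \o (fun x => `|psi j x| `^ r)) /\
    \int[mu_ j]_(x in supp (mu_ j)) (`|psi j x| `^ r) <= B by near: j.
  have [ij _] : (mu_ j).-integrable (supp (mu_ j)) (EFin \o psi j) /\
    \int[mu_ j]_(x in supp (mu_ j)) `|psi j x| <= V by near: j.
  have ihj : (mu_ j).-integrable (supp (mu_ j))
    (EFin \o (fun x => h x * (G (phi j x) * psi j x))) by near: j.
  have mSj := measurable_supp (mu_ j).
  have [N [_ hN]] := continuous_clamp_bounded (ler0n R n.+1) cG.
  have mhj : @measurable_fun _ _ (Borel T) R (supp (mu_ j)) h.
    exact: continuous_measurable_Borel.
  have ivj := integrableM_bounded mSj mhj (fun x _ => hH x)
    (integrableM_bounded mSj (measurable_continuous_comp (@cGN n.+1%:R) (@mphi j))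
      (fun x _ => hN _) ij).
  have ipr := integrableD mSj ipj irj.
  set k := e / _ in d0 tn.
  have ik := integrableZl mSj (H * k) ipr.
  rewrite -RintegralB//.
  have idj := integrableB mSj ihj ivj.
  apply: (le_trans (le_normr_Rintegral mSj idj)).
  apply: (@le_trans _ _ (\int[mu_ j]_(x in supp (mu_ j))
      (H * k * (`|phi j x| `^ p + `|psi j x| `^ r)))).
    apply: le_Rintegral => //; first exact: integrable_norm.
    by move=> x _; rewrite -mulrBr -mulrBl !normrM -mulrA ler_pM ?hH ?mulr_ge0.
  rewrite RintegralZl// RintegralD//.
  have ABle : \int[mu_ j]_(x in supp (mu_ j)) (`|phi j x| `^ p) +
      \int[mu_ j]_(x in supp (mu_ j)) (`|psi j x| `^ r) <= `|A| + `|B| + 1.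
    apply: (le_trans (lerD hpj hrj)); apply: (le_trans (lerD (ler_norm A) (ler_norm B))).
    by rewrite lerDl.
  apply: (le_trans (ler_wpM2l (mulr_ge0 (ltW H0) (ltW d0)) ABle)).
  rewrite le_eqVlt; apply/orP; left; apply/eqP; rewrite /k.
  by move: (`|A| + `|B| + 1) AB0 => S S0; field; rewrite ?gt_eqF.
- by rewrite distrC.
- exact: (cvg_Rintegral_clamp cT wmu mphi sphi mpsi r1 bpsi wpsi (ler0n R n.+1) cG ch).
Unshelve. all: by end_near. Qed.

End LowerSemicontinuity.

(** * Eventual bounds from the upper limit of norms, and the constant sequence 1 *)

Section Norms.
Context {R : realType} {T : pointedMetricType R}.
Variable mu_ : nat -> {finite_measure set (Borel T) -> \bar R}.

(** A finite p-th root forces a finite integral. Positivity of [c], which exceeds a nonnegative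
    root, is recorded so that the p-th power can be undone later. *)
Lemma seq_Lpnorm_lt (p c : R) (phi : nat -> T -> R) : 0 < p ->
  is_sequence mu_ phi -> (seq_Lpnorm mu_ p phi < c%:E)%E ->
  \forall j \near \oo, 0 < c /\
    (mu_ j).-integrable (supp (mu_ j)) (EFin \o (fun x => `|phi j x| `^ p)) /\
    \int[mu_ j]_(x in supp (mu_ j)) (`|phi j x| `^ p) <= c `^ p.
Proof.
move=> p0 mphi /limn_esup_lt_near; apply: filterS => j.
rewrite /LpD; set I := (\int[_]_(_ in _) _)%E => Ic.
have I0 : (0 <= I)%E by apply: integral_ge0 => x _; rewrite lee_fin powR_ge0.
have Ioo : (I < +oo)%E.
  apply: (@lty_poweRy _ _ p^-1); first by rewrite invr_eq0 gt_eqF.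
  exact: lt_trans Ic (ltry _).
have If : I \is a fin_num by rewrite ge0_fin_numE.
move: Ic; rewrite -(fineK If) poweR_EFin lte_fin => Ic.
have c0 : 0 < c by exact: le_lt_trans (powR_ge0 _ _) Ic.
split => //; split.
  apply/integrableP; split.
    by apply/measurable_EFinP; exact: (measurable_norm_powR p (@mphi j)).
  rewrite (_ : (fun x => _) = (fun x => (`|phi j x| `^ p)%:E)) //.
  by apply/funext => x /=; rewrite ger0_norm// powR_ge0.
change (fine I <= c `^ p).
have -> : fine I = (fine I `^ p^-1) `^ p.
  by rewrite -powRrM mulVf ?gt_eqF// powRr1// fine_ge0.
by rewrite ge0_ler_powR ?nnegrE ?powR_ge0 ?(ltW p0) ?(ltW c0)// ltW.
Qed.

Lemma seq_Lpnorm_lty (p : R) (phi : nat -> T -> R) : 0 < p ->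
  is_sequence mu_ phi -> (seq_Lpnorm mu_ p phi < +oo)%E -> exists A : R,
  \forall j \near \oo,
    (mu_ j).-integrable (supp (mu_ j)) (EFin \o (fun x => `|phi j x| `^ p)) /\
    \int[mu_ j]_(x in supp (mu_ j)) (`|phi j x| `^ p) <= A.
Proof.
move=> p0 mphi loo; have [c lc] : exists c : R, (seq_Lpnorm mu_ p phi < c%:E)%E.
  case: (seq_Lpnorm mu_ p phi) loo => [x _|//|_].
    by exists (x + 1); rewrite lte_fin ltrDl.
  by exists 0; exact: ltNyr.
by exists (c `^ p); apply: filterS (seq_Lpnorm_lt p0 mphi lc) => j [].
Qed.

Variable mu : {finite_measure set (Borel T) -> \bar R}.
Hypothesis cT : compact [set: T].
Hypothesis wmu : weak_star_cvg mu_ mu.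

Lemma is_sequence_cst (c : R) : is_sequence mu_ (fun _ _ => c : R).
Proof. by move=> j; exact: measurable_cst. Qed.

(** This is weak-* convergence itself, each measure being carried by its support. *)
Lemma weak_limit_values_cst1 :
  weak_limit_values mu_ mu (fun _ _ => 1 : R) (fun _ => 1 : R).
Proof.
split.
  apply: continuous_integrable_completion => //; last by move=> x; exact: cvg_cst.
  exact: measurable_supp_completion.
move=> h ch.
have E1 : (fun j => \int[mu_ j]_(x in supp (mu_ j)) (h x * 1)%:E)%E =
    (fun j => \int[mu_ j]_x (h x)%:E)%E.
  by apply/funext => j; under eq_integral do rewrite mulr1; exact: integral_supp.
have E2 : (\int[completion mu]_(x in supp mu) (h x * 1)%:E = \int[mu]_x (h x)%:E)%E.
  by under eq_integral do rewrite mulr1; exact: integral_supp_completion.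
rewrite E1 E2; exact: wmu.
Qed.

(** The exponent 2 stands for any r > 1; for the constant 1 the bound is the one on the masses. *)
Lemma cst1_powR_bounded : exists B : R, \forall j \near \oo,
  (mu_ j).-integrable (supp (mu_ j)) (EFin \o (fun x => `|1 : R| `^ 2)) /\
  \int[mu_ j]_(x in supp (mu_ j)) (`|1 : R| `^ 2) <= B.
Proof.
have [V _ hV] := mass_bounded cT wmu; exists V.
move: hV; apply: filterS => j hV.
have mSj := measurable_supp (mu_ j).
rewrite normr1 powR1; split; first exact: finite_measure_integrable_cst.
by rewrite Rintegral_cst// mul1r.
Qed.

End Norms.

Unset Implicit Arguments.
Unset Strict Implicit.

Theorem theorem3p5 (R : realType) (T : pointedMetricType R)
  (mu_ : nat -> {finite_measure set (Borel T) -> \bar R})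
  (mu : {finite_measure set (Borel T) -> \bar R})
  (phi : nat -> T -> R) (phistar : T -> R) :
  compact [set: T] ->
  weak_star_cvg mu_ mu ->
  in_A mu_ mu phi ->
  strong_limit_values mu_ mu phi phistar ->
  (* (1) *)
  (forall (p A : R), 1 < p -> seq_Lpnorm mu_ p phi = A%:E ->
     (LpD (completion mu) (supp mu) p phistar <= A%:E)%E /\
     (forall s : R, 1 <= s < p ->
        forall h : T -> R, continuous h ->
          (fun j => (\int[mu_ j]_(x in supp (mu_ j))
                        (h x * `|phi j x| `^ s)%:E)%E) @ \oo -->
          (\int[completion mu]_(x in supp mu)
              (h x * `|phistar x| `^ s)%:E)%E)) /\
  (* (2) *)
  (forall (p q s : R) (psi : nat -> T -> R) (psi_ : T -> R),
     1 < p -> (seq_Lpnorm mu_ p phi < +oo)%E ->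
     p^-1 + q^-1 = 1 ->
     in_Ap mu_ mu s psi -> q < s ->
     weak_limit_values mu_ mu psi psi_ ->
     forall h : T -> R, continuous h ->
       (fun j => (\int[mu_ j]_(x in supp (mu_ j))
                     (h x * (phi j x * psi j x))%:E)%E) @ \oo -->
       (\int[completion mu]_(x in supp mu)
           (h x * (phistar x * psi_ x))%:E)%E).
Proof.
move=> cT wmu [mphi _] sphi; split.
  move=> p A p1 nA.
  have p0 : 0 < p by exact: lt_trans p1.
  have w1 := weak_limit_values_cst1 cT wmu.
  have m1 := @is_sequence_cst R T mu_ 1.
  have [B hB] := cst1_powR_bounded cT wmu.
  have r1 : (1 < 2 :> R) by rewrite ltr1n.
  split.
    (* An upper limit equal to [A] bounds the norms eventually by A + e, for each e > 0. *)
    apply/lee_addgt0Pr => e e0; rewrite -EFinD.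
    have lc : (seq_Lpnorm mu_ p phi < (A + e)%:E)%E by rewrite nA lte_fin ltrDl.
    have H := seq_Lpnorm_lt p0 mphi lc.
    (* One index suffices to obtain 0 < A + e, where no sign of [A] is given. *)
    have [j [c0 _]] := filter_ex H.
    have le1 : (\int[completion mu]_(x in supp mu) (`|phistar x| `^ p)%:E <=
        ((A + e) `^ p)%:E)%E.
      have := @integral_strong_weak_le _ _ _ _ _ _ cT wmu mphi sphi _ _ _ _ m1 r1 hB w1
        _ (continuous_norm_powR (ltW p1)).
      move=> /(_ _ ((A + e) `^ p)).
      under eq_integral do rewrite mulr1 (ger0_norm (powR_ge0 _ _)).
      apply.
        move=> N t N0; rewrite !(ger0_norm (powR_ge0 _ _)).
        by rewrite ge0_ler_powR ?nnegrE ?(ltW p0)// norm_clamp_le.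
      move: H; apply: filterS => k [_ [ik hk]].
      have E1 : (fun x => `|phi k x| `^ p * 1) = (fun x => `|phi k x| `^ p).
        by apply/funext => x; rewrite mulr1.
      split; first by rewrite E1.
      by under eq_Rintegral do rewrite mulr1 (ger0_norm (powR_ge0 _ _)).
    rewrite /LpD.
    have -> : (A + e)%:E = (((A + e) `^ p)%:E `^ p^-1)%E.
      by rewrite poweR_EFin -powRrM mulfV ?gt_eqF// powRr1// ltW.
    apply: gt0_ler_poweR => //.
    - by rewrite invr_ge0 ltW.
    - by rewrite in_itv/= leey andbT integral_ge0// => x _; rewrite lee_fin powR_ge0.
    - by rewrite in_itv/= leey andbT lee_fin powR_ge0.
  move=> s /andP[s1 sp] h ch.
  have s0 : 0 <= s by exact: le_trans s1.
  have [C hC] : exists C : R, \forall j \near \oo,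
      (mu_ j).-integrable (supp (mu_ j)) (EFin \o (fun x => `|phi j x| `^ p)) /\
      \int[mu_ j]_(x in supp (mu_ j)) (`|phi j x| `^ p) <= C.
    by apply: seq_Lpnorm_lty => //; rewrite nA ltry.
  have Gc N t : 0 <= N -> `| `|clamp N t| `^ s| <= `| `|t| `^ s|.
    move=> N0; rewrite !(ger0_norm (powR_ge0 _ _)).
    by rewrite ge0_ler_powR ?nnegrE// norm_clamp_le.
  have E1 : (fun j => \int[mu_ j]_(x in supp (mu_ j)) (h x * `|phi j x| `^ s)%:E)%E =
      (fun j => \int[mu_ j]_(x in supp (mu_ j)) (h x * (`|phi j x| `^ s * 1))%:E)%E.
    by apply/funext => j; apply: eq_integral => x _; rewrite mulr1.
  have E2 : (\int[completion mu]_(x in supp mu) (h x * `|phistar x| `^ s)%:E =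
      \int[completion mu]_(x in supp mu) (h x * (`|phistar x| `^ s * 1))%:E)%E.
    by apply: eq_integral => x _; rewrite mulr1.
  rewrite E1 E2.
  apply: (@cvg_integral_strong_weak _ _ _ _ _ _ cT wmu mphi sphi _ _ _ _ m1 r1 hB w1
        _ (continuous_norm_powR s1) Gc p C h hC _ ch) => d d0.
  have sp0 : 0 < p - s by rewrite subr_gt0.
  have := powR_nat_cvg0 sp0 d0; apply: filterS => n hn j x.
  rewrite normr1 powR1 mulr1.
  apply: le_trans (norm_powR_clamp_diff _ _ s0 (ltW sp)) _; first by rewrite ltr0n.
  rewrite mulrDr mulr1 (le_trans (ler_wpM2r _ hn)) ?powR_ge0//.
  by rewrite lerDl ltW.
move=> p q s psi psi_ p1 nphi pq [[mpsi _] npsi] qs wpsi h ch.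
have p0 : 0 < p by exact: lt_trans p1.
(* q = p / (p - 1) > 1, hence [s] exceeds 1 and can act as the exponent r for [psi]. *)
have q1 : 1 < q.
  have q1 : q^-1 = (p - 1) / p.
    by rewrite mulrBl divff ?gt_eqF// mul1r -pq addrC addKr.
  rewrite -[q]invrK q1 invf_div ltr_pdivlMr ?subr_gt0// mul1r.
  by rewrite ltrBlDr ltrDl.
have s1 : 1 < s by exact: lt_trans qs.
have [A hA] := seq_Lpnorm_lty p0 mphi nphi.
have [B hB] := seq_Lpnorm_lty (lt_trans ltr01 s1) mpsi npsi.
apply: (@cvg_integral_strong_weak _ _ _ _ _ _ cT wmu mphi sphi _ _ _ _ mpsi s1 hB wpsi
  id _ _ p A h hA _ ch).
- by move=> t; exact: cvg_id.
- by move=> N t; exact: norm_clamp_le.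
- move=> d d0; have := clamp_diff_mul_le p1 pq qs d0.
  by apply: filterS => n hn j x; exact: hn.
Qed.
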